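(* Let $\nu>0$, $b\ge 0$, $a,c\in\mathbb{R}$, $x_0^2:=a^2+4\nu b$, and let $k_m\ge 0$, $\omega_m>0$ be fixed. For a mesh size $h>0$ and time step $\Delta t>0$ put $k_M=\pi/h$, $\omega_M=\pi/\Delta t$, and $D=\{(\omega,k):\omega_m\le|\omega|\le\omega_M,\ k_m\le|k|\le k_M\}$. Assume either $\Delta t=C_h h$ or $\Delta t=C_h h^2$ for a fixed constant $C_h>0$. Then for small $h$ and small $\Delta t$ the Robin best approximation problem with $L=0$, $$\inf_{p\in\mathbb{C}}\sup_{(\omega,k)\in D}|\rho(\omega,k,p,0,0)|,$$ has a unique solution $(p_0^*(0),\delta_0^*(0))$ (minimizer and minimal value), which is given asymptotically by $$p_0^*(0)\sim\sqrt{\frac{A}{Bh}},\qquad \delta_0^*(0)\sim 1-\frac12\sqrt{ABh},$$ where $A$ is the constant defined in the context and $$B=\begin{cases}\dfrac{2}{\nu\pi}&\text{if }\Delta t=C_h h,\\[2mm] C\dfrac{\sqrt{2d}}{\nu\pi}&\text{if }\Delta t=C_h h^2,\end{cases}\qquad d:=\nu\pi C_h,\quad C=\begin{cases}1&\text{if }d<d_0,\\ \sqrt{\dfrac{d+\sqrt{1+d^2}}{1+d^2}}&\text{if }d\ge d_0,\end{cases}$$ with $d_0\approx 1.543679$ the unique real root of $d^3-2d^2+2d-2$.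
   Context: This concerns the optimized Schwarz waveform relaxation algorithm for $\partial_t u+(a,c)\cdot\nabla u-\nu\Delta u+bu=f$ on $\mathbb{R}^2$, decomposed into $\Omega_1=(-\infty,L)\times\mathbb{R}$ and $\Omega_2=(0,\infty)\times\mathbb{R}$ ($L\ge0$ the overlap), with transmission operators $(\nu\nabla-\tfrac{(a,c)^T}{2})\cdot n_i+\tfrac{s}{2}$, $s=p+q(\partial_t+c\partial_y-\nu\Delta_y)$; after Fourier transform in $t$ (variable $\omega$) and $y$ (variable $k$) its convergence factor is $$\rho(\omega,k,p,q,L)=\frac{p+q(\nu k^2+i(\omega+ck))-\sqrt{x_0^2+4\nu(\nu k^2+i(\omega+ck))}}{p+q(\nu k^2+i(\omega+ck))+\sqrt{x_0^2+4\nu(\nu k^2+i(\omega+ck))}}\,e^{-\frac{L}{2\nu}\sqrt{x_0^2+4\nu(\nu k^2+i(\omega+ck))}},$$ where $\sqrt{\cdot}$ is the branch with positive real part. The Robin case is $q=0$. Define $$\bar k=|c|\frac{\sqrt{(c^2+x_0^2)^2+16\nu^2\omega_m^2}-(c^2+x_0^2)}{8\nu^2\omega_m},\qquad \varphi(k,\xi)=2\sqrt2\sqrt{\sqrt{(x_0^2+4\nu^2k^2)^2+16\nu^2\xi^2}+x_0^2+4\nu^2k^2},$$ and $A=\varphi(\bar k,-\omega_m+|c|\bar k)$ if $k_m\le\bar k$; $A=\varphi(k_m,-\omega_m+|c|k_m)$ if $\bar k\le k_m\le\omega_m/|c|$; $A=\varphi(k_m,0)$ if $k_m\ge\omega_m/|c|$.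 Standing assumption: either $x_0^2+4\nu^2k_m^2\neq0$ or $\omega_m\ne0$. The symbol $\sim$ denotes asymptotic equivalence (ratio tending to $1$) as $h\to0$. *)

(* Defs.v *)
From Stdlib Require Import Reals.
From Coquelicot Require Import Coquelicot.
Open Scope R_scope.

Definition x0sq (a b nu : R) : R := a ^ 2 + 4 * nu * b.

(* Principal square root (branch with positive real part off the
   nonpositive real axis):  sqrt(x+iy) = sqrt((|z|+x)/2) + i sgn(y) sqrt((|z|-x)/2). *)
Definition csqrt (z : C) : C :=
  (sqrt ((Cmod z + Re z) / 2),
   (if Rle_dec 0 (Im z) then 1 else -1) * sqrt ((Cmod z - Re z) / 2)).

Definition cexp (z : C) : C := (exp (Re z) * cos (Im z), exp (Re z) * sin (Im z)).

Definition sigma (nu c omega k : R) : C := (nu * k ^ 2, omega + c * k).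

Definition lam (a b c nu omega k : R) : C :=
  csqrt (Cplus (RtoC (x0sq a b nu)) (Cmult (RtoC (4 * nu)) (sigma nu c omega k))).

Definition rho (a b c nu : R) (omega k : R) (p q : C) (L : R) : C :=
  Cmult
    (Cdiv (Cminus (Cplus p (Cmult q (sigma nu c omega k))) (lam a b c nu omega k))
          (Cplus (Cplus p (Cmult q (sigma nu c omega k))) (lam a b c nu omega k)))
    (cexp (Cmult (RtoC (- L / (2 * nu))) (lam a b c nu omega k))).

Definition inD (km om h dt omega k : R) : Prop :=
  om <= Rabs omega <= PI / dt /\ km <= Rabs k <= PI / h.

Definition supRobin (a b c nu km om h dt : R) (p : C) : Rbar :=
  Lub_Rbar (fun r => exists omega k, inD km om h dt omega k /\
                       r = Cmod (rho a b c nu omega k p (RtoC 0) 0)).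

Definition kbar (a b c nu om : R) : R :=
  Rabs c * (sqrt ((c ^ 2 + x0sq a b nu) ^ 2 + 16 * nu ^ 2 * om ^ 2) - (c ^ 2 + x0sq a b nu))
    / (8 * nu ^ 2 * om).

Definition phi (a b nu k xi : R) : R :=
  2 * sqrt 2 * sqrt (sqrt ((x0sq a b nu + 4 * nu ^ 2 * k ^ 2) ^ 2 + 16 * nu ^ 2 * xi ^ 2)
                     + x0sq a b nu + 4 * nu ^ 2 * k ^ 2).

(* the constant A.  The third case "k_m >= omega_m/|c|" is written
   |c| k_m >= omega_m, which is the same for c <> 0 and correctly excludes
   c = 0 (where omega_m/|c| = +infinity). *)
Definition Aconst (a b c nu km om : R) : R :=
  let kb := kbar a b c nu om in
  if Rle_dec km kb then phi a b nu kb (- om + Rabs c * kb)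
  else if Rlt_dec (Rabs c * km) om then phi a b nu km (- om + Rabs c * km)
  else phi a b nu km 0.

Definition Cconst (d0 d : R) : R :=
  if Rlt_dec d d0 then 1 else sqrt ((d + sqrt (1 + d ^ 2)) / (1 + d ^ 2)).

(* the constant B; e = 1 means dt = C_h h, e = 2 means dt = C_h h^2 *)
Definition Bconst (e : nat) (d0 nu Ch : R) : R :=
  match e with
  | 1%nat => 2 / (nu * PI)
  | _ => let d := nu * PI * Ch in Cconst d0 d * sqrt (2 * d) / (nu * PI)
  end.

(* Main.v *)
Require Import Defs.
From Stdlib Require Import Reals Lra ClassicalEpsilon Classical.
From Coquelicot Require Import Coquelicot.
Open Scope R_scope.

(** With [L = 0] and [q = 0], for [0 < delta < 1] the condition
    [|(p - l) / (p + l)| <= delta] says that [p] lies in the closed disk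
    [|p|^2 - 2 T Re (p (conj l)) + |l|^2 <= 0] with [T = (1 + delta^2) / (1 - delta^2)].
    The set of symbols [l] is invariant under conjugation and the disks are strictly convex,
    so the minimizer is unique and real, and the problem becomes the minimization over
    [p > 0] of the supremum of [p / (2 r) + N / (2 p)], where [r = Re l] and [N = |l|^2 / r].
    Up to lower order terms this supremum is the maximum of [p / (2 min r)] and
    [sup N / (2 p)], which balance at [p = sqrt (min r * sup N)].  It remains to see that
    [min r = A / 4] and [h sup N -> 4 / B].  The former is a constrained minimization in [k]
    whose free critical point is [kbar].  For the latter, [h N] depends on the rescaled
    argument [h^2 l^2], which ranges asymptotically over a rectangle; [N] is maximal there at
    one of the two corners of largest imaginary part, and [d0] is where they exchange roles. *)

(** * Existence of a minimizer for the real minimax problem *)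

(* [(1 + delta^2) / (1 - delta^2)] for [delta = |(p - l) / (p + l)|] with [p] real,
   [r = Re l] and [N = |l|^2 / r]. *)
Definition gval (p r N : R) : R := p / (2 * r) + N / (2 * p).

(** The difference is [p - c] times a difference of two bounded nonnegative terms. The constant
    depends on [r] and [N] only through [m] and [M], so the estimate passes to the supremum over all
    pairs. *)
Lemma gval_lipschitz (m M c p r N : R) :
  0 < m -> 0 < c -> c / 2 <= p -> m <= r -> 0 <= N <= M ->
  Rabs (gval p r N - gval c r N) <= (/ (2 * m) + M / (c * c)) * Rabs (p - c).
Proof.
  intros Hm Hc Hp Hr HN.
  assert (Hp0 : 0 < p) by lra.
  replace (gval p r N - gval c r N) with ((/ (2 * r) - N / (2 * p * c)) * (p - c))
    by (unfold gval; field; lra).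
  rewrite Rabs_mult; apply Rmult_le_compat_r; [apply Rabs_pos|].
  assert (H1 : 0 <= / (2 * r) <= / (2 * m)).
  { split; [left; apply Rinv_0_lt_compat; lra|apply Rinv_le_contravar; lra]. }
  assert (H2 : 0 <= N / (2 * p * c) <= M / (c * c)).
  { assert (0 < c * c) by nra. assert (0 < 2 * p * c) by nra.
    split.
    - apply Rmult_le_pos; [lra|left; apply Rinv_0_lt_compat; lra].
    - apply Rmult_le_compat; try lra.
      + left; apply Rinv_0_lt_compat; lra.
      + apply Rinv_le_contravar; nra. }
  apply Rabs_le; lra.
Qed.

Lemma Lub_Rbar_is_finite (E : R -> Prop) (u : R) :
  (exists y, E y) -> (forall y, E y -> y <= u) ->
  is_lub_Rbar E (Finite (real (Lub_Rbar E))).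
Proof.
  intros [y Hy] Hu.
  destruct (Lub_Rbar_correct E) as [H1 H2].
  assert (H3 := H1 y Hy).
  assert (H4 : Rbar_le (Lub_Rbar E) (Finite u)) by (apply H2; intros x Hx; now apply Hu).
  destruct (Lub_Rbar E) as [l| |]; simpl in *; try contradiction.
  now split.
Qed.

(** The upper envelope of the functions [p -> gval p r N] is continuous, and a single pair already
    makes it large near [0] and near infinity. A minimum over a suitable compact interval is
    therefore global. *)
Lemma real_minimax_exists (K : R -> R -> Prop) (m M : R) :
  0 < m ->
  (forall r N, K r N -> m <= r /\ 0 < N <= M) ->
  (exists r N, K r N) ->
  exists p T, 0 < p /\ (forall r N, K r N -> gval p r N <= T) /\
    (forall p' T', 0 < p' -> (forall r N, K r N -> gval p' r N <= T') -> T <= T').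
Proof.
  intros Hm HK [r0 [N0 H0]].
  set (E := fun p y => exists r N, K r N /\ y = gval p r N).
  set (G := fun p => real (Lub_Rbar (E p))).
  assert (HG : forall p, 0 < p -> is_lub_Rbar (E p) (Finite (G p))).
  { intros p Hp. apply Lub_Rbar_is_finite with (p / (2 * m) + M / (2 * p)).
    - now exists (gval p r0 N0), r0, N0.
    - intros y [r [N [HrN ->]]]. destruct (HK _ _ HrN) as [Hr HN].
      unfold gval. apply Rplus_le_compat.
      + apply Rmult_le_compat_l; [lra|]. apply Rinv_le_contravar; lra.
      + apply Rmult_le_compat_r; [|lra]. left; apply Rinv_0_lt_compat; lra. }
  assert (HGu : forall p r N, 0 < p -> K r N -> gval p r N <= G p).
  { intros p r N Hp HrN. apply (proj1 (HG p Hp)). now exists r, N. }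
  assert (HGl : forall p T, 0 < p -> (forall r N, K r N -> gval p r N <= T) -> G p <= T).
  { intros p T Hp HT. apply (proj2 (HG p Hp) (Finite T)).
    intros y [r [N [HrN ->]]]. now apply HT. }
  assert (Hcont : forall c, 0 < c -> continuity_pt G c).
  { intros c Hc eps Heps.
    assert (HM : 0 < M) by (destruct (HK _ _ H0); lra).
    set (L := / (2 * m) + M / (c * c)).
    assert (HL : 0 < L).
    { unfold L. assert (0 < / (2 * m)) by (apply Rinv_0_lt_compat; lra).
      assert (0 < M / (c * c)) by (apply Rdiv_lt_0_compat; nra). lra. }
    (* The radius [c / 2] keeps [p >= c / 2], as the Lipschitz bound requires. *)
    exists (Rmin (c / 2) (eps / L)). split.
    - apply Rmin_pos; [lra|]. apply Rdiv_lt_0_compat; lra.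
    - intros p [_ Hp]. simpl in *. unfold Rdist in *.
      assert (Hp1 := Rlt_le_trans _ _ _ Hp (Rmin_l _ _)).
      assert (Hp2 := Rlt_le_trans _ _ _ Hp (Rmin_r _ _)).
      assert (Hp3 : c / 2 <= p) by (apply Rabs_def2 in Hp1; lra).
      assert (HLe : L * Rabs (p - c) < eps).
      { apply Rmult_lt_compat_l with (r := L) in Hp2; [|lra].
        replace (L * (eps / L)) with eps in Hp2 by (field; lra). exact Hp2. }
      assert (Hlip : forall r N, K r N -> Rabs (gval p r N - gval c r N) <= L * Rabs (p - c)).
      { intros r N HrN. destruct (HK _ _ HrN). apply gval_lipschitz; lra. }
      assert (G p <= G c + L * Rabs (p - c)).
      { apply HGl; [lra|]. intros r N HrN.
        assert (Hx := Hlip r N HrN). apply Rabs_le_between in Hx.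
        assert (Hy := HGu c r N Hc HrN). lra. }
      assert (G c <= G p + L * Rabs (p - c)).
      { apply HGl; [lra|]. intros r N HrN.
        assert (Hx := Hlip r N HrN). apply Rabs_le_between in Hx.
        assert (Hy := HGu p r N ltac:(lra) HrN). lra. }
      apply Rle_lt_trans with (L * Rabs (p - c)); [|exact HLe].
      apply Rabs_le; lra. }
  destruct (HK _ _ H0) as [Hr0 HN0].
  assert (Hg1 : 0 < G 1).
  { apply Rlt_le_trans with (gval 1 r0 N0); [|apply HGu; auto; lra].
    unfold gval. assert (0 < 1 / (2 * r0)) by (apply Rdiv_lt_0_compat; lra).
    assert (0 < N0 / (2 * 1)) by (apply Rdiv_lt_0_compat; lra). lra. }
  (* The pair [(r0, N0)] alone pushes the envelope to at least [G 1] when [p <= N0 / (2 * G 1)] or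
     [p >= 2 * r0 * G 1]. Cutting off at [1] keeps the competitor [1] inside [[al, be]]. *)
  set (al := Rmin 1 (N0 / (2 * G 1))). set (be := Rmax 1 (2 * r0 * G 1)).
  assert (Hal : 0 < al) by (apply Rmin_pos; [lra|apply Rdiv_lt_0_compat; lra]).
  assert (Hal1 : al <= 1) by apply Rmin_l.
  assert (Hbe1 : 1 <= be) by apply Rmax_l.
  destruct (continuity_ab_min G al be) as [p [Hmin Hp]]; [lra| |].
  { intros c Hc; apply Hcont; lra. }
  assert (HpG1 : G p <= G 1) by (apply Hmin; lra).
  exists p, (G p). split; [lra|]. split.
  { intros r N HrN; apply HGu; auto; lra. }
  intros p' T' Hp' HT'.
  assert (HGT : G p' <= T') by (apply HGl; auto).
  destruct (Rle_dec al p') as [Hpa|Hpa]; [destruct (Rle_dec p' be) as [Hpb|Hpb]|].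
  - apply Rle_trans with (G p'); auto.
  - apply Rle_trans with (G 1); auto. apply Rle_trans with (gval p' r0 N0); auto.
    assert (Hx : 2 * r0 * G 1 <= p') by (assert (Hy := Rmax_r 1 (2 * r0 * G 1)); fold be in Hy; lra).
    apply Rle_trans with (p' / (2 * r0)).
    + apply Rmult_le_reg_r with (2 * r0); [lra|].
      replace (p' / (2 * r0) * (2 * r0)) with p' by (field; lra). lra.
    + unfold gval. assert (0 < N0 / (2 * p')) by (apply Rdiv_lt_0_compat; lra). lra.
  - apply Rle_trans with (G 1); auto. apply Rle_trans with (gval p' r0 N0); auto.
    assert (Hx : p' <= N0 / (2 * G 1)).
    { assert (Hy := Rmin_r 1 (N0 / (2 * G 1))); fold al in Hy; lra. }
    apply Rle_trans with (N0 / (2 * p')).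
    + apply Rmult_le_compat_l with (r := 2 * G 1) in Hx; [|lra].
      replace (2 * G 1 * (N0 / (2 * G 1))) with N0 in Hx by (field; lra).
      apply Rmult_le_reg_r with (2 * p'); [lra|].
      replace (N0 / (2 * p') * (2 * p')) with N0 by (field; lra). lra.
    + unfold gval. assert (0 < p' / (2 * r0)) by (apply Rdiv_lt_0_compat; lra). lra.
Qed.

(** * Disk conditions and the complex minimax problem *)

Definition normsq (z : C) : R := fst z ^ 2 + snd z ^ 2.

Lemma Cmod_sqr (z : C) : Cmod z ^ 2 = normsq z.
Proof.
  unfold Cmod, normsq. rewrite pow2_sqrt; [reflexivity|]. nra.
Qed.

Definition robinSup (K : C -> Prop) (q : C) : Rbar :=
  Lub_Rbar (fun s => exists l, K l /\ s = Cmod (Cdiv (Cminus q l) (Cplus q l))).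

Lemma normsq_pos (z : C) : z <> RtoC 0 -> 0 < normsq z.
Proof.
  intros Hz. rewrite <- Cmod_sqr. apply pow_lt. now apply Cmod_gt_0.
Qed.

(* For d < 1 the sublevel set is the Apollonius disk with centre [T l], where
   [T = (1 + d^2) / (1 - d^2)]. *)
Lemma Cmod_ratio_le (q l : C) (d T : R) :
  0 <= d -> 1 <= T -> d ^ 2 * (T + 1) = T - 1 -> Cplus q l <> RtoC 0 ->
  (Cmod (Cdiv (Cminus q l) (Cplus q l)) <= d <->
   normsq q + normsq l <= 2 * T * (fst q * fst l + snd q * snd l)).
Proof.
  intros Hd HT HdT Hne.
  rewrite Cmod_div by exact Hne.
  assert (Hpos := normsq_pos _ Hne).
  assert (Hc : 0 < Cmod (Cplus q l)) by now apply Cmod_gt_0.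
  assert (Hc0 := Cmod_ge_0 (Cminus q l)).
  assert (H1 := Cmod_sqr (Cplus q l)). assert (H2 := Cmod_sqr (Cminus q l)).
  set (u := Cmod (Cminus q l)) in *. set (v := Cmod (Cplus q l)) in *.
  assert (Hs : normsq (Cplus q l) = normsq q + normsq l + 2 * (fst q * fst l + snd q * snd l)).
  { unfold normsq, Cplus; simpl; ring. }
  assert (Hm : normsq (Cminus q l) = normsq q + normsq l - 2 * (fst q * fst l + snd q * snd l)).
  { unfold normsq, Cminus, Cplus, Copp; simpl; ring. }
  set (S := normsq q + normsq l) in *. set (c := fst q * fst l + snd q * snd l) in *.
  assert (Hiff : u ^ 2 <= (d * v) ^ 2 <-> S <= 2 * T * c).
  { replace ((d * v) ^ 2) with (d ^ 2 * (v ^ 2)) by ring.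
    rewrite H1, H2, Hs, Hm.
    assert (Hd2 : d ^ 2 = (T - 1) / (T + 1)) by (rewrite <- HdT; field; lra).
    rewrite Hd2.
    (* After clearing [T + 1], the two squared sides differ by twice the slack in the disk
       inequality. *)
    assert (HE : (T + 1) * ((T - 1) / (T + 1) * (S + 2 * c) - (S - 2 * c)) = 2 * (2 * T * c - S))
      by (field; lra).
    split; intros H; nra. }
  rewrite <- Hiff. split; intros H.
  - apply pow_incr. split; [lra|].
    apply Rmult_le_compat_r with (r := v) in H; [|lra].
    unfold Rdiv in H; rewrite Rmult_assoc, Rinv_l, Rmult_1_r in H; lra.
  - apply Rmult_le_reg_r with v; [lra|].
    unfold Rdiv; rewrite Rmult_assoc, Rinv_l, Rmult_1_r by lra.
    apply Rsqr_incr_0; [unfold Rsqr; simpl in H; lra|lra|nra].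
Qed.

(** For real [q = p] the right side is the disk inequality of [Cmod_ratio_le]; this is the passage
    from the complex quotient to [gval]. *)
Lemma gval_le_iff (p T r n : R) :
  0 < p -> 0 < r -> (gval p r (n / r) <= T <-> p ^ 2 + n <= 2 * T * (p * r)).
Proof.
  intros Hp Hr.
  assert (HE : (2 * p * r) * gval p r (n / r) = p ^ 2 + n) by (unfold gval; field; lra).
  assert (0 < 2 * p * r) by (repeat apply Rmult_lt_0_compat; lra).
  rewrite <- HE. split; intros H1; nra.
Qed.

(* Conjugation symmetry and strict convexity of the disks: the midpoint of any
   competitor, its conjugate and [p] would beat [p] by a fixed margin. *)
Lemma complex_minimizer_unique (K : C -> Prop) (m M p T : R) (q : C) :
  0 < m ->
  (forall l, K l -> m <= fst l <= M) ->
  (forall l, K l -> K (fst l, - snd l)) ->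
  0 < p -> 0 < T ->
  (forall l, K l -> gval p (fst l) (normsq l / fst l) <= T) ->
  (forall p' T', 0 < p' ->
     (forall l, K l -> gval p' (fst l) (normsq l / fst l) <= T') -> T <= T') ->
  (exists l, K l) ->
  0 < fst q ->
  (forall l, K l -> normsq q + normsq l <= 2 * T * (fst q * fst l + snd q * snd l)) ->
  q = RtoC p.
Proof.
  intros Hm HK Hsym Hp HT Hpu Hmin [l0 Hl0] Hq Hqu.
  destruct q as [u v]; simpl in *.
  assert (HMm : 0 < M) by (destruct (HK _ Hl0); lra).
  (* Averaging the conditions for [q] and its conjugate removes [v] from the right side. Averaging
     the result with the condition for [p] leaves [eta] as the surplus over [w ^ 2]. *)
  set (w := (u + p) / 2). set (eta := v ^ 2 / 2 + (u - p) ^ 2 / 4).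
  assert (Hw : 0 < w) by (unfold w; lra).
  assert (Heta : 0 <= eta).
  { unfold eta. assert (H1 := pow2_ge_0 v). assert (H2 := pow2_ge_0 (u - p)). lra. }
  assert (Hkey : forall l, K l -> w ^ 2 + normsq l + eta <= 2 * T * (w * fst l)).
  { intros l Hl. assert (Ha := Hqu _ Hl). assert (Hb := Hqu _ (Hsym _ Hl)).
    assert (Hc := Hpu _ Hl). rewrite gval_le_iff in Hc by (destruct (HK _ Hl); lra).
    unfold normsq, w, eta in *; simpl in *. nra. }
  (* Since [fst l <= M], the slack [eta] lowers the level at [w] by at least [eta / (2 * w * M)] for
     all [l] at once, so minimality of [T] forces [eta = 0]. *)
  assert (Hlt : T <= T - eta / (2 * w * M)).
  { apply Hmin with w; auto. intros l Hl. destruct (HK _ Hl) as [Hr1 Hr2].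
    apply gval_le_iff; try lra. assert (Hk := Hkey _ Hl).
    assert (Hx : 2 * (eta / (2 * w * M)) * (w * fst l) <= eta).
    { replace (2 * (eta / (2 * w * M)) * (w * fst l)) with (eta * (fst l / M)) by (field; lra).
      rewrite <- (Rmult_1_r eta) at 2. apply Rmult_le_compat_l; auto.
      apply Rmult_le_reg_r with M; auto. unfold Rdiv; rewrite Rmult_assoc, Rinv_l; lra. }
    lra. }
  assert (Heta0 : eta = 0).
  { assert (Hle : eta / (2 * w * M) <= 0) by lra.
    apply Rmult_le_compat_r with (r := 2 * w * M) in Hle; [|nra].
    unfold Rdiv in Hle; rewrite Rmult_assoc, Rinv_l in Hle by nra. lra. }
  assert (Hv1 := pow2_ge_0 v). assert (Hu1 := pow2_ge_0 (u - p)). unfold eta in Heta0.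
  assert (Hv2 : v ^ 2 = 0) by lra. assert (Hu2 : (u - p) ^ 2 = 0) by lra.
  assert (Hv : v = 0) by nra.
  assert (Hu : u = p) by nra.
  now rewrite Hv, Hu.
Qed.

(** The level [T] increases with the quotient bound [delta], so the real minimizer of [T] is a
    minimizer of [delta = sqrt ((T - 1) / (T + 1))] over real [p]. A complex competitor that does as
    well is first shown to have positive real part, which makes the uniqueness argument
    applicable. *)
Lemma robin_minimax (K : C -> Prop) (m M : R) :
  0 < m ->
  (forall l, K l -> m <= fst l <= M) ->
  (forall l, K l -> normsq l <= M ^ 2) ->
  (forall l, K l -> snd l ^ 2 <= fst l ^ 2) ->
  (forall l, K l -> K (fst l, - snd l)) ->
  (forall q, exists l, K l /\ l <> q) ->
  exists p T, 0 < p /\ 1 <= T /\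
    (forall l, K l -> gval p (fst l) (normsq l / fst l) <= T) /\
    (forall p' T', 0 < p' ->
       (forall l, K l -> gval p' (fst l) (normsq l / fst l) <= T') -> T <= T') /\
    robinSup K (RtoC p) = Finite (sqrt ((T - 1) / (T + 1))) /\
    (forall q, Rbar_le (robinSup K q) (robinSup K (RtoC p)) -> q = RtoC p).
Proof.
  intros Hm HK HKM Hcone Hsym Htwo.
  destruct (Htwo (RtoC 0)) as [l0 [Hl0 _]].
  assert (HM : 0 < M) by (destruct (HK _ Hl0); lra).
  destruct (real_minimax_exists
              (fun r N => exists l, K l /\ r = fst l /\ N = normsq l / fst l) m (M ^ 2 / m))
    as [p [T [Hp [Hpu Hmin]]]]; auto.
  { intros r N [l [Hl [-> ->]]]. assert (Hr := HK _ Hl). assert (Hn := HKM _ Hl).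
    assert (0 < normsq l) by (unfold normsq; nra).
    split; [lra|]. split.
    - apply Rdiv_lt_0_compat; lra.
    - apply Rmult_le_compat; try lra.
      + left; apply Rinv_0_lt_compat; lra.
      + apply Rinv_le_contravar; lra. }
  { now exists (fst l0), (normsq l0 / fst l0), l0. }
  assert (Hpu' : forall l, K l -> gval p (fst l) (normsq l / fst l) <= T).
  { intros l Hl; apply Hpu; now exists l. }
  assert (Hmin' : forall p' T', 0 < p' ->
       (forall l, K l -> gval p' (fst l) (normsq l / fst l) <= T') -> T <= T').
  { intros p' T' Hp' H; apply Hmin with p'; auto. intros r N [l [Hl [-> ->]]]; auto. }
  clear Hpu Hmin.
  assert (HT : 1 <= T).
  { assert (H := Hpu' _ Hl0). assert (Hr := HK _ Hl0). rewrite gval_le_iff in H by lra.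
    assert (Hpr : 0 < p * fst l0) by nra.
    assert (H1 := pow2_ge_0 (p - fst l0)). assert (H2 := pow2_ge_0 (snd l0)).
    unfold normsq in H.
    apply Rmult_le_reg_r with (2 * (p * fst l0)); lra. }
  assert (Hq0 : 0 <= (T - 1) / (T + 1)) by (apply Rdiv_le_0_compat; lra).
  set (d := sqrt ((T - 1) / (T + 1))).
  assert (Hd0 : 0 <= d) by apply sqrt_pos.
  assert (Hd2 : d ^ 2 = (T - 1) / (T + 1)) by (apply pow2_sqrt; auto).
  assert (Hd2' : d ^ 2 * (T + 1) = T - 1) by (rewrite Hd2; field; lra).
  assert (Hd1 : d < 1) by (apply Rnot_le_lt; intros H; assert (1 <= d ^ 2) by nra; nra).
  assert (Hnz : forall q l, 0 < fst q -> K l -> Cplus q l <> RtoC 0).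
  { intros q l Hq Hl E. apply (f_equal fst) in E. simpl in E.
    assert (Hr := HK _ Hl). lra. }
  assert (Hsup : robinSup K (RtoC p) = Finite d).
  { apply is_lub_Rbar_unique. split.
    - intros y [l [Hl ->]]. simpl. apply (proj2 (Cmod_ratio_le (RtoC p) l d T Hd0 HT Hd2' (Hnz (RtoC p) l Hp Hl))).
      assert (H := Hpu' _ Hl). rewrite gval_le_iff in H by (destruct (HK _ Hl); lra).
      unfold normsq in *; simpl in *; lra.
    - intros [b| |] Hb; simpl; auto.
      + apply Rnot_lt_le; intros Hlt.
        assert (Hb0 : 0 <= b).
        { eapply Rle_trans; [apply Cmod_ge_0|].
          apply (Hb (Cmod (Cdiv (Cminus (RtoC p) l0) (Cplus (RtoC p) l0)))). now exists l0. }
        assert (Hb1 : 0 < 1 - b ^ 2) by nra.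
        assert (Hbd : b ^ 2 < d ^ 2) by nra.
        (* An upper bound [b < d] of the quotients would give a level [T'] below the minimal level
           [T]. *)
        set (T' := (1 + b ^ 2) / (1 - b ^ 2)).
        assert (HE : T' * (1 - b ^ 2) = 1 + b ^ 2) by (unfold T'; field; lra).
        assert (HT' : 1 <= T') by nra.
        assert (T <= T').
        { apply Hmin' with p; auto. intros l Hl. apply gval_le_iff; try (destruct (HK _ Hl); lra).
          assert (H := Hb _ (ex_intro _ l (conj Hl eq_refl))). simpl in H.
          apply (proj1 (Cmod_ratio_le _ _ b T' Hb0 HT' ltac:(lra) (Hnz (RtoC p) l Hp Hl))) in H.
          unfold normsq in *; simpl in *; lra. }
        nra.
      + apply (Hb (Cmod (Cdiv (Cminus (RtoC p) l0) (Cplus (RtoC p) l0)))). now exists l0. }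
  exists p, T. repeat split; auto.
  intros q Hq. rewrite Hsup in Hq.
  assert (Hqd : forall l, K l -> Cmod (Cdiv (Cminus q l) (Cplus q l)) <= d).
  { intros l Hl. apply (Rbar_le_trans (Finite _) (robinSup K q) (Finite d)); auto.
    apply (proj1 (Lub_Rbar_correct _)). now exists l. }
  assert (Hqpos : 0 < fst q).
  { apply Rnot_le_lt; intros Hneg.
    (* A symbol different from [- q] keeps the denominator [q + l] nonzero. *)
    destruct (Htwo (Copp q)) as [l [Hl Hlq]].
    assert (Hne : Cplus q l <> RtoC 0).
    { intros E. apply Hlq. apply (f_equal (fun z => Cplus z (Copp q))) in E.
      replace l with (Cplus (Cplus q l) (Copp q)) by ring. rewrite E. ring. }
    assert (H := Hqd _ Hl).
    (* Averaging the disk conditions for [l] and [conj l] forces [fst q > 0]; if [q] is the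
       pole [- conj l], where the quotient is [0], the condition for [l] alone fails. *)
    assert (Hl' := Hsym _ Hl).
    apply (Cmod_ratio_le _ _ d T) in H; auto.
    destruct (classic (Cplus q (fst l, - snd l) = RtoC 0)) as [E|E].
    - assert (E1 := f_equal fst E). assert (E2 := f_equal snd E). simpl in E1, E2.
      assert (Hr := HK _ Hl). unfold normsq in H.
      destruct q as [u v], l as [r s]; simpl in *.
      replace u with (- r) in H by lra. replace v with s in H by lra.
      assert (Hc := Hcone _ Hl). simpl in Hc. nra.
    - assert (H' := Hqd _ Hl'). apply (Cmod_ratio_le _ _ d T) in H'; auto.
      assert (Hr := HK _ Hl). unfold normsq in *; destruct q as [u v], l as [r s]; simpl in *.
      assert (u * r <= 0) by nra. nra. }
  apply complex_minimizer_unique with (K := K) (m := m) (M := M) (T := T); auto; try lra.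
  - now exists l0.
  - intros l Hl. apply (proj1 (Cmod_ratio_le q l d T Hd0 HT Hd2' (Hnz q l Hqpos Hl))); auto.
Qed.

(** * One-sided limits at zero and asymptotics of the minimax value *)

Lemma at_right_0_intro (P : R -> Prop) (eta : R) :
  0 < eta -> (forall h, 0 < h < eta -> P h) -> at_right 0 P.
Proof.
  intros Heta HP. exists (mkposreal _ Heta). intros h Hh Hpos.
  apply HP. split; auto.
  unfold ball in Hh; simpl in Hh; unfold AbsRing_ball, abs, minus, plus, opp in Hh; simpl in Hh.
  apply Rabs_def2 in Hh. lra.
Qed.

Lemma at_right_0_elim (P : R -> Prop) :
  at_right 0 P -> exists eta, 0 < eta /\ forall h, 0 < h < eta -> P h.
Proof.
  intros [d Hd]. exists d. split; [apply cond_pos|].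
  intros h Hh. apply Hd; [|lra].
  unfold ball; simpl; unfold AbsRing_ball, abs, minus, plus, opp; simpl.
  apply Rabs_def1; lra.
Qed.

Lemma filterlim_at_right_0 (f : R -> R) (l : R) :
  (forall eps, 0 < eps -> exists eta, 0 < eta /\
     forall h, 0 < h < eta -> Rabs (f h - l) < eps) <->
  filterlim f (at_right 0) (locally l).
Proof.
  split.
  - intros H. apply filterlim_locally. intros eps.
    destruct (H eps (cond_pos eps)) as [eta [Heta Hh]].
    apply at_right_0_intro with eta; auto.
  - intros H eps Heps. apply at_right_0_elim.
    apply (proj1 (filterlim_locally f l) H (mkposreal _ Heps)).
Qed.

Lemma filterlim_at_right_0_continuous (f : R -> R) :
  continuous f 0 -> filterlim f (at_right 0) (locally (f 0)).
Proof.
  intros H. apply filterlim_filter_le_1 with (2 := H). apply filter_le_within.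
Qed.

(* The point [r = m] forces [T >= p / (2 m)] and the points with [h N ~ n] force
   [T >= n / (2 p h)]; the two bounds balance at [p = sqrt (m n / h)].  For the converse,
   the set is split at a fixed large [r = R]: since [N <= 2 r], the term [N / (2 p)]
   is negligible below [R], and [p / (2 r)] is negligible above. *)
Lemma minimax_asymptotics (K : R -> R -> R -> Prop) (m n h0 : R) (p T : R -> R) :
  0 < m -> 0 < n -> 0 < h0 ->
  (forall h r N, 0 < h < h0 -> K h r N -> m <= r /\ 0 < N <= 2 * r) ->
  (forall h, 0 < h < h0 -> exists N, K h m N) ->
  (forall eps, 0 < eps -> exists eta, 0 < eta /\
     forall h r N, 0 < h < eta -> K h r N -> h * N <= n * (1 + eps)) ->
  (forall eps, 0 < eps -> exists eta, 0 < eta /\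
     forall h, 0 < h < eta -> exists r N, K h r N /\ n * (1 - eps) <= h * N) ->
  (forall h, 0 < h < h0 -> 0 < p h /\ (forall r N, K h r N -> gval (p h) r N <= T h) /\
     (forall p' T', 0 < p' -> (forall r N, K h r N -> gval p' r N <= T') -> T h <= T')) ->
  filterlim (fun h => p h / sqrt (m * n / h)) (at_right 0) (locally 1) /\
  filterlim (fun h => T h / (sqrt (m * n / h) / (2 * m))) (at_right 0) (locally 1).
Proof.
  intros Hm Hn Hh0 HK Hatt Hup Hlow Hpt.
  assert (Hmain : forall eps, 0 < eps < 1 / 2 -> exists eta, 0 < eta /\
    forall h, 0 < h < eta ->
      1 - 2 * eps <= p h / sqrt (m * n / h) <= 1 + eps /\
      1 - eps <= T h / (sqrt (m * n / h) / (2 * m)) <= 1 + eps).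
  { intros eps Heps.
    destruct (Hup (eps / 2)) as [eta1 [Heta1 Hup1]]; [lra|].
    destruct (Hlow eps) as [eta2 [Heta2 Hlow2]]; [lra|].
    (* Beyond this [r], the term [P / (2 * r)] is at most the fraction [eps / 2] of
       [P / (2 * m)]. *)
    set (Rr := 2 * m / eps).
    assert (HRr : 0 < Rr) by (apply Rdiv_lt_0_compat; lra).
    assert (Heta3 : 0 < eps * n / (2 * Rr)) by (apply Rdiv_lt_0_compat; nra).
    exists (Rmin (Rmin h0 eta1) (Rmin eta2 (eps * n / (2 * Rr)))).
    split; [repeat apply Rmin_pos; auto|].
    intros h [Hh Hlt].
    assert (Ha := Rlt_le_trans _ _ _ Hlt (Rmin_l _ _)).
    assert (Hb := Rlt_le_trans _ _ _ Hlt (Rmin_r _ _)).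
    assert (Hh_0 := Rlt_le_trans _ _ _ Ha (Rmin_l _ _)).
    assert (Hh_1 := Rlt_le_trans _ _ _ Ha (Rmin_r _ _)).
    assert (Hh_2 := Rlt_le_trans _ _ _ Hb (Rmin_l _ _)).
    assert (Hh_3 := Rlt_le_trans _ _ _ Hb (Rmin_r _ _)).
    clear Ha Hb Hlt.
    assert (Hq : 0 < m * n / h) by (apply Rdiv_lt_0_compat; nra).
    set (P := sqrt (m * n / h)).
    assert (HP : 0 < P) by now apply sqrt_lt_R0.
    assert (HP2 : P * P = m * n / h) by (apply sqrt_sqrt; lra).
    (* This is the balance of the two lower bounds at [p = P]. *)
    assert (HnP : n / (h * P) = P / m).
    { apply Rmult_eq_reg_r with (P * m); [|nra].
      replace (n / (h * P) * (P * m)) with (m * n / h) by (field; lra).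
      rewrite <- HP2; field; lra. }
    destruct (Hpt h) as [Hp [HpT Hmin]]; [lra|].
    set (p1 := p h) in *. set (T1 := T h) in *.
    set (T0 := P / (2 * m)).
    assert (HT0 : 0 < T0) by (apply Rdiv_lt_0_compat; lra).
    assert (HTu : T1 <= T0 * (1 + eps)).
    { apply Hmin with P; auto. intros r N HrN.
      destruct (HK h r N) as [Hr HN]; auto.
      unfold gval, T0. destruct (Rle_dec r Rr) as [HrR|HrR].
      - assert (H1 : P / (2 * r) <= P / (2 * m)).
        { apply Rmult_le_compat_l; [lra|]. apply Rinv_le_contravar; lra. }
        assert (H2 : N / (2 * P) <= P / (2 * m) * eps).
        { apply Rle_trans with (Rr / P).
          - apply Rmult_le_reg_r with (2 * P); [lra|].
            replace (N / (2 * P) * (2 * P)) with N by (field; lra).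
            replace (Rr / P * (2 * P)) with (2 * Rr) by (field; lra). lra.
          - apply Rmult_le_reg_r with (2 * m * P); [nra|].
            replace (Rr / P * (2 * m * P)) with (2 * m * Rr) by (field; lra).
            replace (P / (2 * m) * eps * (2 * m * P)) with (eps * (P * P)) by (field; lra).
            rewrite HP2.
            apply Rmult_le_reg_r with (h / m); [apply Rdiv_lt_0_compat; lra|].
            replace (2 * m * Rr * (h / m)) with (h * (2 * Rr)) by (field; lra).
            replace (eps * (m * n / h) * (h / m)) with (eps * n / (2 * Rr) * (2 * Rr))
              by (field; lra).
            apply Rmult_le_compat_r; lra. }
        lra.
      - assert (H1 : P / (2 * r) <= P / (2 * m) * (eps / 2)).
        { replace (P / (2 * m) * (eps / 2)) with (P / (2 * Rr)) by (unfold Rr; field; lra).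
          apply Rmult_le_compat_l; [lra|]. apply Rinv_le_contravar; lra. }
        assert (H2 : N / (2 * P) <= P / (2 * m) * (1 + eps / 2)).
        { assert (H3 := Hup1 h r N (conj Hh Hh_1) HrN).
          replace (P / (2 * m) * (1 + eps / 2)) with (P / m * (1 + eps / 2) / 2) by (field; lra).
          rewrite <- HnP.
          apply Rmult_le_reg_r with (2 * (h * P)); [nra|].
          replace (N / (2 * P) * (2 * (h * P))) with (h * N) by (field; lra).
          replace (n / (h * P) * (1 + eps / 2) / 2 * (2 * (h * P))) with (n * (1 + eps / 2))
            by (field; lra). lra. }
        lra. }
    (* Dropping one positive term of [gval] at each kind of extremal pair gives [HTl1] and [HTl2].
       Together with the upper bound [HTu] they enclose both [p1] and [T1]. *)
    assert (HTl1 : p1 <= 2 * m * T1).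
    { destruct (Hatt h) as [N HmN]; auto. assert (H1 := HpT _ _ HmN).
      destruct (HK h m N) as [_ HN]; auto. unfold gval in H1.
      assert (0 < N / (2 * p1)) by (apply Rdiv_lt_0_compat; lra).
      apply Rle_trans with (2 * m * (p1 / (2 * m))); [right; field; lra|].
      apply Rmult_le_compat_l; lra. }
    assert (HTl2 : P * P * (1 - eps) <= 2 * m * (p1 * T1)).
    { destruct (Hlow2 h) as [r [N [HrN HN]]]; auto. assert (H1 := HpT _ _ HrN).
      destruct (HK h r N) as [Hr HN2]; auto. unfold gval in H1.
      assert (0 < p1 / (2 * r)) by (apply Rdiv_lt_0_compat; lra).
      assert (H2 : N <= 2 * p1 * T1).
      { apply Rle_trans with (2 * p1 * (N / (2 * p1))); [right; field; lra|].
        apply Rmult_le_compat_l; lra. }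
      rewrite HP2. apply Rmult_le_reg_r with (h / m); [apply Rdiv_lt_0_compat; lra|].
      replace (m * n / h * (1 - eps) * (h / m)) with (n * (1 - eps)) by (field; lra).
      replace (2 * m * (p1 * T1) * (h / m)) with (h * (2 * p1 * T1)) by (field; lra).
      apply Rle_trans with (h * N); auto. apply Rmult_le_compat_l; lra. }
    assert (HT0P : 2 * m * T0 = P) by (unfold T0; field; lra).
    assert (HT1 : 0 < T1) by nra.
    assert (Hp1u : p1 <= P * (1 + eps)) by nra.
    assert (Hp1l : P * (1 - 2 * eps) <= p1).
    { assert (H1 : P * P * (1 - eps) <= p1 * (P * (1 + eps))).
      { apply Rle_trans with (p1 * (2 * m * T1)); [lra|]. apply Rmult_le_compat_l; nra. }
      assert (H2 : P * (1 - eps) <= p1 * (1 + eps)).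
      { apply Rmult_le_reg_r with P; lra. }
      apply Rmult_le_reg_r with (1 + eps); [lra|]. nra. }
    assert (HTl : T0 * (1 - eps) <= T1).
    { apply Rnot_lt_le; intros Hlt.
      assert (H1 : p1 * T1 <= 2 * m * (T1 * T1)) by nra.
      assert (H2 : P * P * (1 - eps) <= (2 * m * T1) * (2 * m * T1)) by nra.
      assert (H3 : 2 * m * T1 < P * (1 - eps)) by nra.
      assert (H4 : 0 < 2 * m * T1) by nra.
      assert (H5 : (2 * m * T1) * (2 * m * T1) < (P * (1 - eps)) * (P * (1 - eps))).
      { apply Rmult_le_0_lt_compat; lra. }
      assert (0 < P * P) by nra. nra. }
    assert (Hdiv : forall x y u v, 0 < y -> y * u <= x -> x <= y * v -> u <= x / y <= v).
    { intros x y u v Hy H1 H2. split; apply Rmult_le_reg_r with y; auto;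
        unfold Rdiv; rewrite Rmult_assoc, Rinv_l by lra; lra. }
    split; apply Hdiv; auto. }
  split; apply filterlim_at_right_0; intros eps Heps;
    destruct (Hmain (Rmin (eps / 4) (1 / 4))) as [eta [Heta Hh]];
    try (split; [apply Rmin_pos; lra|]; apply Rle_lt_trans with (1 / 4); [apply Rmin_r|lra]);
    exists eta; (split; [exact Heta|]); intros h Hh1;
    destruct (Hh h Hh1) as [H1 H2]; assert (H3 := Rmin_l (eps / 4) (1 / 4));
    apply Rabs_def1; lra.
Qed.

(** With [t = 1 / T], rationalizing gives [1 - delta = t * psi t], where [psi] is continuous at [0]
    with value [1]. Hence [1 - delta] is equivalent to [1 / T], and so to [1 / t0]. *)
Lemma one_minus_delta_asymptotics (T t0 : R -> R) :
  filterlim (fun h => T h / t0 h) (at_right 0) (locally 1) ->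
  filterlim (fun h => / t0 h) (at_right 0) (locally 0) ->
  (exists eta, 0 < eta /\ forall h, 0 < h < eta -> 0 < t0 h /\ 1 <= T h) ->
  filterlim (fun h => (1 - sqrt ((T h - 1) / (T h + 1))) * t0 h) (at_right 0) (locally 1).
Proof.
  intros Hu Ht0 [eta [Heta Hpos]].
  set (psi := fun t => 2 / ((1 + t) * (1 + sqrt ((1 - t) / (1 + t))))).
  assert (Hv : filterlim (fun h => / (T h / t0 h)) (at_right 0) (locally 1)).
  { replace 1 with (/ 1) by field. apply (filterlim_comp _ _ _ _ Rinv _ _ _ Hu).
    apply (continuous_Rinv 1); lra. }
  assert (Ht : filterlim (fun h => / (T h / t0 h) * / t0 h) (at_right 0) (locally 0)).
  { replace 0 with (1 * 0) at 2 by ring.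
    apply (filterlim_comp_2 _ _ Rmult Hv Ht0). apply (filterlim_mult (K := R_AbsRing) 1 0). }
  assert (Hpsi : filterlim psi (locally 0) (locally 1)).
  { replace 1 with (psi 0).
    2:{ unfold psi. replace ((1 - 0) / (1 + 0)) with 1 by field. rewrite sqrt_1. field. }
    apply (ex_derive_continuous (V := R_NormedModule)). unfold psi. auto_derive.
    replace ((1 - 0) / (1 + 0)) with 1 by field.
    repeat split; try lra; rewrite ?sqrt_1; try lra.
    all: replace ((1 + - 0) * / (1 + 0)) with 1 by field; rewrite ?sqrt_1; lra. }
  assert (Hres : filterlim (fun h => psi (/ (T h / t0 h) * / t0 h) * / (T h / t0 h))
                   (at_right 0) (locally 1)).
  { replace 1 with (1 * 1) by ring.
    apply (filterlim_comp_2 _ _ Rmult (filterlim_comp _ _ _ _ _ _ _ _ Ht Hpsi) Hv).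
    apply (filterlim_mult (K := R_AbsRing) 1 1). }
  apply filterlim_ext_loc with (2 := Hres).
  apply at_right_0_intro with eta; auto. intros h Hh.
  destruct (Hpos h Hh) as [Hp HT]. set (x := T h) in *. set (y := t0 h) in *.
  replace (/ (x / y) * / y) with (/ x) by (field; lra).
  unfold psi. replace ((1 - / x) / (1 + / x)) with ((x - 1) / (x + 1)) by (field; lra).
  set (d := sqrt ((x - 1) / (x + 1))).
  assert (Hd0 : 0 <= d) by apply sqrt_pos.
  assert (Hd2 : d * d = (x - 1) / (x + 1)) by (apply sqrt_sqrt, Rdiv_le_0_compat; lra).
  assert (HE : (1 - d) * (1 + d) = 2 / (x + 1)).
  { replace ((1 - d) * (1 + d)) with (1 - d * d) by ring. rewrite Hd2. field; lra. }
  replace (1 - d) with (2 / (x + 1) / (1 + d)) by (rewrite <- HE; field; lra).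
  field; lra.
Qed.

(** * Real part of the principal square root *)

(** The real part of [csqrt (x, y)]. *)
Definition reSqrt (x y : R) : R := sqrt ((sqrt (x ^ 2 + y ^ 2) + x) / 2).

Lemma sqrt_sum_sqr_ge (x y : R) : Rabs x <= sqrt (x ^ 2 + y ^ 2).
Proof.
  rewrite <- sqrt_Rsqr_abs. apply sqrt_le_1_alt. unfold Rsqr. nra.
Qed.

Lemma normsq_csqrt (x y : R) : normsq (csqrt (x, y)) = sqrt (x ^ 2 + y ^ 2).
Proof.
  unfold normsq, csqrt, Cmod, Re, Im; cbn [fst snd].
  assert (H := sqrt_sum_sqr_ge x y).
  assert (H1 := Rle_abs x). assert (H2 := Rle_abs (- x)). rewrite Rabs_Ropp in H2.
  rewrite pow2_sqrt by lra. rewrite Rpow_mult_distr, pow2_sqrt by lra.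
  destruct (Rle_dec 0 y); field.
Qed.

(** Roots of numbers in the right half-plane have argument at most [pi / 4] in absolute value;
    [robin_minimax] asks for this cone condition. *)
Lemma snd_csqrt_le (x y : R) : 0 <= x -> snd (csqrt (x, y)) ^ 2 <= fst (csqrt (x, y)) ^ 2.
Proof.
  intros Hx. assert (H := sqrt_sum_sqr_ge x y). assert (H1 := Rle_abs x).
  unfold csqrt, Cmod, Re, Im; cbn [fst snd].
  rewrite Rpow_mult_distr, !pow2_sqrt by lra. destruct (Rle_dec 0 y); lra.
Qed.

Lemma csqrt_conj (x y : R) :
  0 <= x -> csqrt (x, - y) = (fst (csqrt (x, y)), - snd (csqrt (x, y))).
Proof.
  intros Hx. unfold csqrt, Cmod, Re, Im; cbn [fst snd].
  replace ((- y) ^ 2) with (y ^ 2) by ring. f_equal.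
  destruct (Rtotal_order y 0) as [Hy|[->|Hy]].
  - destruct (Rle_dec 0 (- y)); [|lra]. destruct (Rle_dec 0 y); lra.
  (* At [y = 0] the sign in [csqrt] is [1] for both arguments, so the imaginary part has to vanish;
     [0 <= x] ensures it. *)
  - replace ((sqrt (x ^ 2 + 0 ^ 2) - x) / 2) with 0; [rewrite sqrt_0; ring|].
    replace (x ^ 2 + 0 ^ 2) with (x ^ 2) by ring. rewrite sqrt_pow2 by lra. lra.
  - destruct (Rle_dec 0 (- y)); [lra|]. destruct (Rle_dec 0 y); lra.
Qed.

(** The squared real part [r] solves [4 r (r - x) = y^2], that is [(2 r - x)^2 = x^2 + y^2]. In the
    form [r = x + y^2 / (4 r)], bounds on the real part become inequalities free of roots. *)
Lemma reSqrt_ge (x y r : R) :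
  0 < r -> r <= x + y ^ 2 / (4 * r) -> sqrt r <= reSqrt x y.
Proof.
  intros Hr H. apply sqrt_le_1_alt.
  assert (H1 : (2 * r - x) ^ 2 <= x ^ 2 + y ^ 2).
  { apply Rmult_le_compat_l with (r := 4 * r) in H; [|lra].
    replace (4 * r * (x + y ^ 2 / (4 * r))) with (4 * r * x + y ^ 2) in H by (field; lra). nra. }
  assert (H2 : 2 * r - x <= sqrt (x ^ 2 + y ^ 2)); [|lra].
  apply Rle_trans with (Rabs (2 * r - x)); [apply Rle_abs|].
  rewrite <- sqrt_Rsqr_abs. apply sqrt_le_1_alt. unfold Rsqr. lra.
Qed.

Lemma reSqrt_eq (x y r : R) :
  0 < r -> r = x + y ^ 2 / (4 * r) -> reSqrt x y = sqrt r.
Proof.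
  intros Hr H. unfold reSqrt. f_equal.
  assert (Hy : y ^ 2 = 4 * r * (r - x)).
  { apply (f_equal (fun u => 4 * r * (u - x))) in H. rewrite H. field; lra. }
  assert (Hx : 0 <= 2 * r - x) by (assert (H2 := pow2_ge_0 y); nra).
  replace (x ^ 2 + y ^ 2) with ((2 * r - x) ^ 2) by (rewrite Hy; ring).
  rewrite sqrt_pow2 by exact Hx. field.
Qed.

Lemma reSqrt_fixpoint (x y : R) :
  0 <= x -> 0 < x \/ y <> 0 ->
  0 < reSqrt x y ^ 2 /\ reSqrt x y ^ 2 = x + y ^ 2 / (4 * reSqrt x y ^ 2).
Proof.
  intros Hx Hxy. assert (H := sqrt_sum_sqr_ge x y). assert (H1 := Rle_abs x).
  assert (Hpos : 0 < sqrt (x ^ 2 + y ^ 2)).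
  { apply sqrt_lt_R0. destruct Hxy; [nra|]. assert (0 < y ^ 2) by (apply pow2_gt_0; auto). nra. }
  unfold reSqrt. rewrite pow2_sqrt by lra. split; [lra|].
  assert (Hs : sqrt (x ^ 2 + y ^ 2) ^ 2 = x ^ 2 + y ^ 2) by (apply pow2_sqrt; nra).
  set (s := sqrt (x ^ 2 + y ^ 2)) in *.
  replace (y ^ 2) with ((s - x) * (s + x)) by (rewrite <- (Rplus_minus_l (x ^ 2) (y ^ 2)), <- Hs; ring).
  field; lra.
Qed.

Lemma reSqrt_pos (x y : R) : 0 <= x -> 0 < x \/ y <> 0 -> 0 < reSqrt x y.
Proof.
  intros Hx Hxy. destruct (reSqrt_fixpoint x y Hx Hxy) as [H _].
  assert (0 <= reSqrt x y) by apply sqrt_pos. nra.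
Qed.

Lemma reSqrt_ge_x (x y : R) : 0 <= x -> sqrt x <= reSqrt x y.
Proof.
  intros Hx. apply sqrt_le_1_alt. assert (H := sqrt_sum_sqr_ge x y).
  assert (H1 := Rle_abs x). lra.
Qed.

(** * The symbol as a function of the frequencies *)

(** [symx] and [symy] are the real and imaginary parts of the argument of the root in [lam]. *)
Definition symx (a b nu k : R) : R := x0sq a b nu + 4 * nu ^ 2 * k ^ 2.
Definition symy (c nu w k : R) : R := 4 * nu * (w + c * k).

Lemma lam_csqrt (a b c nu w k : R) :
  lam a b c nu w k = csqrt (symx a b nu k, symy c nu w k).
Proof.
  unfold lam, Defs.sigma, symx, symy, Cplus, Cmult, RtoC. cbn [fst snd].
  apply (f_equal csqrt), injective_projections; cbn [fst snd]; ring.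
Qed.

Lemma fst_lam (a b c nu w k : R) :
  fst (lam a b c nu w k) = reSqrt (symx a b nu k) (symy c nu w k).
Proof. now rewrite lam_csqrt. Qed.

Lemma x0sq_nonneg (a b nu : R) : 0 < nu -> 0 <= b -> 0 <= x0sq a b nu.
Proof. intros Hnu Hb. unfold x0sq. assert (H := pow2_ge_0 a). nra. Qed.

Lemma symx_nonneg (a b nu k : R) : 0 < nu -> 0 <= b -> 0 <= symx a b nu k.
Proof.
  intros Hnu Hb. assert (H := x0sq_nonneg a b nu Hnu Hb). unfold symx.
  assert (0 <= (nu * k) ^ 2) by apply pow2_ge_0. nra.
Qed.

Lemma sym_nonzero (a b c nu w k : R) :
  0 < nu -> 0 <= b -> w <> 0 -> 0 < symx a b nu k \/ symy c nu w k <> 0.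
Proof.
  intros Hnu Hb Hw. destruct (Req_dec k 0) as [->|Hk].
  - right. unfold symy. rewrite Rmult_0_r, Rplus_0_r. apply Rmult_integral_contrapositive; lra.
  - left. unfold symx. assert (H := x0sq_nonneg a b nu Hnu Hb).
    assert (0 < (nu * k) ^ 2) by (apply pow2_gt_0, Rmult_integral_contrapositive; lra). nra.
Qed.

Lemma phi_reSqrt (a b nu k xi : R) :
  phi a b nu k xi = 4 * reSqrt (symx a b nu k) (4 * nu * xi).
Proof.
  unfold phi, reSqrt. fold (symx a b nu k).
  replace (16 * nu ^ 2 * xi ^ 2) with ((4 * nu * xi) ^ 2) by ring.
  rewrite Rplus_assoc. fold (symx a b nu k).
  set (w := sqrt (symx a b nu k ^ 2 + (4 * nu * xi) ^ 2) + symx a b nu k).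
  replace w with (2 * (w / 2)) at 1 by field.
  rewrite sqrt_mult_alt by lra.
  replace (2 * sqrt 2 * (sqrt 2 * sqrt (w / 2))) with (2 * (sqrt 2 * sqrt 2) * sqrt (w / 2)) by ring.
  rewrite sqrt_sqrt by lra. ring.
Qed.

(** * Minimal real part of the symbol *)

(* Cauchy-Schwarz: [(eta + g k)^2 <= (k^2 + eta^2 / r) (r + g^2)]. *)
Lemma kbar_level_bound (X g nu om r k eta : R) :
  0 < r -> 0 < om -> (r - X) * (r + g ^ 2) = 4 * nu ^ 2 * om ^ 2 -> om <= eta + g * k ->
  r <= X + 4 * nu ^ 2 * k ^ 2 + (4 * nu * eta) ^ 2 / (4 * r).
Proof.
  intros Hr Hom HE Hle.
  assert (Hcs : om ^ 2 <= (k ^ 2 + eta ^ 2 / r) * (r + g ^ 2)).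
  { apply Rle_trans with ((eta + g * k) ^ 2); [apply pow_incr; lra|].
    assert (H : (k ^ 2 + eta ^ 2 / r) * (r + g ^ 2) - (eta + g * k) ^ 2 = (k * r - g * eta) ^ 2 / r)
      by (field; lra).
    assert (0 <= (k * r - g * eta) ^ 2 / r) by (apply Rdiv_le_0_compat; [apply pow2_ge_0|lra]).
    lra. }
  assert (Hg : 0 < r + g ^ 2) by (assert (H := pow2_ge_0 g); lra).
  apply Rmult_le_reg_r with (r + g ^ 2); auto.
  replace ((4 * nu * eta) ^ 2 / (4 * r)) with (4 * nu ^ 2 * (eta ^ 2 / r)) by (field; lra).
  assert (Hn : 0 <= 4 * nu ^ 2) by (assert (H := pow2_ge_0 nu); lra).
  apply (Rmult_le_compat_l _ _ _ Hn) in Hcs. nra.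
Qed.

(* Tangent-line bound for [eta^2] at [eta0 = om - g k0]. *)
Lemma beyond_kbar_bound (X g nu om r k0 k eta : R) :
  0 < r -> 0 <= g -> 0 <= k0 <= k -> g * k0 < om -> g * om <= k0 * (r + g ^ 2) ->
  r = X + 4 * nu ^ 2 * k0 ^ 2 + (4 * nu * (om - g * k0)) ^ 2 / (4 * r) -> om <= eta + g * k ->
  r <= X + 4 * nu ^ 2 * k ^ 2 + (4 * nu * eta) ^ 2 / (4 * r).
Proof.
  intros Hr Hg Hk Hlt Hkb HE Hle. rewrite HE at 1.
  set (eta0 := om - g * k0).
  assert (Heta0 : 0 < eta0) by (unfold eta0; lra).
  replace ((4 * nu * eta0) ^ 2 / (4 * r)) with (4 * nu ^ 2 * (eta0 ^ 2 / r)) by (field; lra).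
  replace ((4 * nu * eta) ^ 2 / (4 * r)) with (4 * nu ^ 2 * (eta ^ 2 / r)) by (field; lra).
  assert (Hn : 0 <= 4 * nu ^ 2) by (assert (H := pow2_ge_0 nu); lra).
  enough (Hx : k0 ^ 2 + eta0 ^ 2 / r <= k ^ 2 + eta ^ 2 / r).
  { apply (Rmult_le_compat_l _ _ _ Hn) in Hx. lra. }
  apply Rmult_le_reg_r with r; auto.
  replace ((k0 ^ 2 + eta0 ^ 2 / r) * r) with (k0 ^ 2 * r + eta0 ^ 2) by (field; lra).
  replace ((k ^ 2 + eta ^ 2 / r) * r) with (k ^ 2 * r + eta ^ 2) by (field; lra).
  assert (H1 : eta0 - g * (k - k0) <= eta) by (unfold eta0; lra).
  assert (H2 : g * eta0 <= k0 * r) by (unfold eta0; nra).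
  assert (H3 : 2 * eta0 * (eta0 - g * (k - k0)) - eta0 ^ 2 <= eta ^ 2).
  { assert (H4 := pow2_ge_0 (eta - eta0)).
    assert (2 * eta0 * (eta0 - g * (k - k0)) <= 2 * eta0 * eta) by (apply Rmult_le_compat_l; lra).
    lra. }
  assert (H5 : g * eta0 * (k - k0) <= k0 * r * (k - k0)) by (apply Rmult_le_compat_r; lra).
  assert (H6 : 0 <= r * (k - k0) ^ 2) by (apply Rmult_le_pos; [lra|apply pow2_ge_0]).
  nra.
Qed.

(** Here [r] is the square of the least real part over unconstrained [k], obtained as the larger
    root of the quadratic. [kbar] is the equality case [k r = g eta] of Cauchy-Schwarz with
    [g = |c|] and [eta = om - g k]. *)
Lemma kbar_level (a b c nu om : R) :
  0 < nu -> 0 <= b -> 0 < om ->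
  exists r, 0 < r /\ (r - x0sq a b nu) * (r + Rabs c ^ 2) = 4 * nu ^ 2 * om ^ 2 /\
    0 <= kbar a b c nu om /\ kbar a b c nu om * (r + Rabs c ^ 2) = Rabs c * om.
Proof.
  intros Hnu Hb Hom. assert (HX := x0sq_nonneg a b nu Hnu Hb).
  unfold kbar. rewrite <- (pow2_abs c). set (g := Rabs c). set (X := x0sq a b nu) in *.
  assert (Hg : 0 <= g) by apply Rabs_pos.
  assert (Hg2 := pow2_ge_0 g).
  assert (Hno : 0 < nu ^ 2 * om ^ 2) by (apply Rmult_lt_0_compat; apply pow_lt; auto).
  set (u := g ^ 2 + X). assert (Hu : 0 <= u) by (unfold u; lra).
  assert (HS2 : sqrt (u ^ 2 + 16 * nu ^ 2 * om ^ 2) ^ 2 = u ^ 2 + 16 * nu ^ 2 * om ^ 2)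
    by (apply pow2_sqrt; nra).
  assert (HSu : u < sqrt (u ^ 2 + 16 * nu ^ 2 * om ^ 2)).
  { rewrite <- (sqrt_pow2 u) at 1 by exact Hu. apply sqrt_lt_1_alt. split; [nra|lra]. }
  set (S := sqrt (u ^ 2 + 16 * nu ^ 2 * om ^ 2)) in *.
  assert (Hd : 0 < 8 * nu ^ 2 * om) by (assert (0 < nu ^ 2) by (apply pow_lt; auto); nra).
  exists ((S + u) / 2 - g ^ 2).
  assert (Hr : X < (S + u) / 2 - g ^ 2) by (unfold u in *; lra).
  repeat split.
  - lra.
  - replace (((S + u) / 2 - g ^ 2 - X) * ((S + u) / 2 - g ^ 2 + g ^ 2)) with ((S ^ 2 - u ^ 2) / 4)
      by (unfold u; field). rewrite HS2. field.
  - apply Rdiv_le_0_compat; auto. apply Rmult_le_pos; lra.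
  - replace (g * (S - u) / (8 * nu ^ 2 * om) * ((S + u) / 2 - g ^ 2 + g ^ 2))
      with (g * (S ^ 2 - u ^ 2) / (16 * nu ^ 2 * om)) by (field; lra).
    rewrite HS2. field; lra.
Qed.

Lemma abs_symbol_bound (c om w k : R) :
  om <= Rabs w -> om <= Rabs (w + c * k) + Rabs c * Rabs k.
Proof.
  intros H. rewrite <- Rabs_mult.
  assert (H1 := Rabs_triang (w + c * k) (- (c * k))). rewrite Rabs_Ropp in H1.
  replace (w + c * k + - (c * k)) with w in H1 by ring. lra.
Qed.

Lemma symy_abs_sqr (c nu w k : R) : symy c nu w k ^ 2 = (4 * nu * Rabs (w + c * k)) ^ 2.
Proof.
  unfold symy. rewrite !Rpow_mult_distr, pow2_abs. ring.
Qed.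

(** The lower bound needs the constraint on [w] only through [om <= eta + |c| |k|], where
    [eta = |w + c k|]. If [km <= kbar] the free minimum is admissible; otherwise the minimum lies at
    [|k| = km] with [eta] as small as possible, namely [om - |c| km] or [0]. *)
Lemma reSqrt_min (a b c nu km om : R) :
  0 < nu -> 0 <= b -> 0 <= km -> 0 < om ->
  (forall w k, om <= Rabs w -> km <= Rabs k ->
     Aconst a b c nu km om / 4 <= reSqrt (symx a b nu k) (symy c nu w k)) /\
  (exists w k, om <= Rabs w /\ km <= Rabs k /\
     Aconst a b c nu km om / 4 = reSqrt (symx a b nu k) (symy c nu w k)).
Proof.
  intros Hnu Hb Hkm Hom.
  destruct (kbar_level a b c nu om Hnu Hb Hom) as [r [Hr [Hlev [Hkb Hkbr]]]].
  assert (HX := x0sq_nonneg a b nu Hnu Hb).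
  set (g := Rabs c) in *. assert (Hg : 0 <= g) by apply Rabs_pos.
  assert (Hx : forall k, symx a b nu k = x0sq a b nu + 4 * nu ^ 2 * Rabs k ^ 2)
    by (intros k; rewrite pow2_abs; reflexivity).
  (* The sign of [w] is chosen opposite to that of [c], so that [|w + c k0| = |om - |c| k0|]. *)
  assert (Hatt : forall k0, 0 <= k0 -> km <= k0 -> exists w k, om <= Rabs w /\ km <= Rabs k /\
     phi a b nu k0 (- om + g * k0) / 4 = reSqrt (symx a b nu k) (symy c nu w k)).
  { intros k0 Hk0 Hk0m. unfold g, Rabs at 3. destruct (Rcase_abs c) as [Hc|Hc].
    - exists om, k0. rewrite !Rabs_pos_eq by lra. split; [lra|]. split; [lra|].
      rewrite phi_reSqrt. unfold symy, reSqrt.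
      replace ((4 * nu * (- om + - c * k0)) ^ 2) with ((4 * nu * (om + c * k0)) ^ 2) by ring. field.
    - exists (- om), k0. rewrite Rabs_Ropp, !Rabs_pos_eq by lra. split; [lra|]. split; [lra|].
      rewrite phi_reSqrt. unfold symy. field. }
  unfold Aconst. fold g. set (kb := kbar a b c nu om) in *.
  destruct (Rle_dec km kb) as [H1|H1]; [|destruct (Rlt_dec (g * km) om) as [H2|H2]].
  - split; [|apply Hatt; lra].
    intros w k Hw Hk.
    replace (phi a b nu kb (- om + g * kb) / 4) with (sqrt r).
    + apply reSqrt_ge; auto. rewrite symy_abs_sqr, Hx.
      apply kbar_level_bound with (g := g) (om := om); auto. apply abs_symbol_bound; auto.
    + rewrite phi_reSqrt. rewrite (reSqrt_eq _ _ r); auto; [field|].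
      unfold symx.
      assert (Hgr : r + g ^ 2 <> 0) by (assert (H := pow2_ge_0 g); lra).
      assert (Ekb : kb = g * om / (r + g ^ 2)) by (rewrite <- Hkbr; field; auto).
      assert (EX : x0sq a b nu = r - 4 * nu ^ 2 * om ^ 2 / (r + g ^ 2)) by (rewrite <- Hlev; field; auto).
      rewrite EX, Ekb. field. split; auto; lra.
  - split; [|apply Hatt; lra].
    intros w k Hw Hk.
    assert (Hnz : 0 < symx a b nu km \/ 4 * nu * (- om + g * km) <> 0).
    { right. apply Rmult_integral_contrapositive. lra. }
    destruct (reSqrt_fixpoint _ _ (symx_nonneg a b nu km Hnu Hb) Hnz) as [Hr0 Er0].
    rewrite phi_reSqrt.
    set (q := reSqrt (symx a b nu km) (4 * nu * (- om + g * km))) in *.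
    (* Comparison with the free minimum: from [r <= q ^ 2] and [kb < km] follows
       [g * om <= km * (q ^ 2 + g ^ 2)], the condition that [km] is past the critical point. *)
    assert (Hrq : sqrt r <= q).
    { apply reSqrt_ge; auto.
      replace ((4 * nu * (- om + g * km)) ^ 2) with ((4 * nu * (om - g * km)) ^ 2) by ring.
      apply kbar_level_bound with (g := g) (om := om); auto. lra. }
    assert (Hq0 : 0 <= q) by apply sqrt_pos.
    assert (Hrq2 : r <= q ^ 2).
    { rewrite <- (sqrt_sqrt r) by lra. assert (H := sqrt_pos r). nra. }
    replace (4 * q / 4) with (sqrt (q ^ 2)) by (rewrite sqrt_pow2 by auto; field).
    apply reSqrt_ge; auto. rewrite symy_abs_sqr, Hx.
    apply beyond_kbar_bound with (g := g) (om := om) (k0 := km); auto; try lra.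
    + rewrite <- Hkbr.
      apply Rmult_le_compat; try lra. assert (H := pow2_ge_0 g); lra.
    + rewrite Er0 at 1. unfold symx.
      replace ((4 * nu * (- om + g * km)) ^ 2) with ((4 * nu * (om - g * km)) ^ 2) by ring.
      reflexivity.
    + apply abs_symbol_bound; auto.
  - assert (E : phi a b nu km 0 / 4 = sqrt (symx a b nu km)).
    { rewrite phi_reSqrt. unfold reSqrt.
      replace (symx a b nu km ^ 2 + (4 * nu * 0) ^ 2) with (symx a b nu km ^ 2) by ring.
      rewrite sqrt_pow2 by now apply symx_nonneg.
      replace ((symx a b nu km + symx a b nu km) / 2) with (symx a b nu km) by field. field. }
    rewrite E. split.
    + intros w k Hw Hk. apply Rle_trans with (sqrt (symx a b nu k)).
      * apply sqrt_le_1_alt. rewrite (Hx k). unfold symx. apply Rplus_le_compat_l.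
        apply Rmult_le_compat_l; [assert (H := pow2_ge_0 nu); lra|]. apply pow_incr; lra.
      * apply reSqrt_ge_x, symx_nonneg; auto.
    (* This [w] cancels the imaginary part, and it is admissible because [|c| km >= om]. *)
    + exists (- (c * km)), km. rewrite Rabs_Ropp, Rabs_mult, (Rabs_pos_eq km) by lra. fold g.
      split; [lra|]. split; [lra|]. rewrite <- E, phi_reSqrt. unfold symy.
      replace (4 * nu * (- (c * km) + c * km)) with (4 * nu * 0) by ring. field.
Qed.

(** * The quotient [N] and its maximum over a rectangle *)

(* [|l|^2 / Re l] for [l = sqrt (x + i y)]. *)
Definition nval (x y : R) : R := sqrt (x ^ 2 + y ^ 2) / reSqrt x y.

Lemma normsq_lam_div (a b c nu w k : R) :
  normsq (lam a b c nu w k) / fst (lam a b c nu w k) = nval (symx a b nu k) (symy c nu w k).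
Proof. now rewrite fst_lam, lam_csqrt, normsq_csqrt. Qed.

Lemma reSqrt_pow2 (x y : R) : reSqrt x y ^ 2 = (sqrt (x ^ 2 + y ^ 2) + x) / 2.
Proof.
  apply pow2_sqrt. assert (H := sqrt_sum_sqr_ge x y).
  assert (H2 := Rle_abs (- x)). rewrite Rabs_Ropp in H2. lra.
Qed.

Lemma nval_bounds (x y : R) :
  0 <= x -> 0 < x \/ y <> 0 -> 0 < nval x y <= 2 * reSqrt x y.
Proof.
  intros Hx Hxy. assert (Hr := reSqrt_pos x y Hx Hxy). assert (E := reSqrt_pow2 x y).
  assert (Hz : 0 < sqrt (x ^ 2 + y ^ 2)).
  { assert (H := sqrt_sum_sqr_ge x y). assert (H1 := Rle_abs x).
    assert (0 < reSqrt x y ^ 2) by (apply pow_lt; auto). lra. }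
  split; [now apply Rdiv_lt_0_compat|].
  unfold nval. apply Rmult_le_reg_r with (reSqrt x y); auto.
  unfold Rdiv; rewrite Rmult_assoc, Rinv_l by lra. nra.
Qed.

(** At fixed [y] this makes [N] a convex function [r + Q / r^3] of the real part alone. *)
Lemma nval_reSqrt (x y : R) :
  0 <= x -> 0 < x \/ y <> 0 ->
  nval x y = reSqrt x y + y ^ 2 / 4 / reSqrt x y ^ 3.
Proof.
  intros Hx Hxy. assert (Hr := reSqrt_pos x y Hx Hxy).
  destruct (reSqrt_fixpoint x y Hx Hxy) as [_ E]. assert (E2 := reSqrt_pow2 x y).
  unfold nval. set (r := reSqrt x y) in *.
  replace (sqrt (x ^ 2 + y ^ 2)) with (r ^ 2 + (r ^ 2 - x)) by lra.
  rewrite E at 2. field. lra.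
Qed.

Lemma reSqrt_scale (h x y : R) : 0 < h -> reSqrt (h ^ 2 * x) (h ^ 2 * y) = h * reSqrt x y.
Proof.
  intros Hh. unfold reSqrt.
  replace ((h ^ 2 * x) ^ 2 + (h ^ 2 * y) ^ 2) with ((h ^ 2) ^ 2 * (x ^ 2 + y ^ 2)) by ring.
  rewrite sqrt_mult_alt by nra. rewrite sqrt_pow2 by nra.
  replace ((h ^ 2 * sqrt (x ^ 2 + y ^ 2) + h ^ 2 * x) / 2)
    with (h ^ 2 * ((sqrt (x ^ 2 + y ^ 2) + x) / 2)) by field.
  rewrite sqrt_mult_alt by nra. rewrite sqrt_pow2 by lra. reflexivity.
Qed.

Lemma nval_scale (h x y : R) :
  0 < h -> 0 <= x -> 0 < x \/ y <> 0 -> h * nval x y = nval (h ^ 2 * x) (h ^ 2 * y).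
Proof.
  intros Hh Hx Hxy. unfold nval. rewrite reSqrt_scale by auto.
  replace ((h ^ 2 * x) ^ 2 + (h ^ 2 * y) ^ 2) with ((h ^ 2) ^ 2 * (x ^ 2 + y ^ 2)) by ring.
  rewrite sqrt_mult_alt by nra. rewrite sqrt_pow2 by nra.
  assert (Hr := reSqrt_pos x y Hx Hxy). field. lra.
Qed.

Lemma nval_0_l (y : R) : 0 <= y -> nval 0 y = sqrt (2 * y).
Proof.
  intros Hy. unfold nval, reSqrt.
  replace (0 ^ 2 + y ^ 2) with (y ^ 2) by ring. rewrite sqrt_pow2 by auto. rewrite Rplus_0_r.
  destruct (Req_dec y 0) as [->|Hy0].
  { unfold Rdiv. now rewrite !Rmult_0_r, sqrt_0, Rmult_0_l. }
  assert (Hs : 0 < sqrt (y / 2)) by (apply sqrt_lt_R0; lra).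
  apply Rmult_eq_reg_r with (sqrt (y / 2)); [|lra].
  unfold Rdiv at 1; rewrite Rmult_assoc, Rinv_l by lra. rewrite <- sqrt_mult_alt by lra.
  replace (2 * y * (y / 2)) with (y ^ 2) by field. rewrite sqrt_pow2; lra.
Qed.

Lemma nval_0_r (x : R) : 0 < x -> nval x 0 = sqrt x.
Proof.
  intros Hx. unfold nval, reSqrt.
  replace (x ^ 2 + 0 ^ 2) with (x ^ 2) by ring. rewrite sqrt_pow2 by lra.
  replace ((x + x) / 2) with x by field.
  assert (Hs : 0 < sqrt x) by (apply sqrt_lt_R0; lra).
  rewrite <- (sqrt_sqrt x) at 1 by lra. field. lra.
Qed.

Lemma reSqrt_incr_x (x x' y : R) : 0 <= x <= x' -> reSqrt x y <= reSqrt x' y.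
Proof.
  intros Hx. apply sqrt_le_1_alt.
  assert (sqrt (x ^ 2 + y ^ 2) <= sqrt (x' ^ 2 + y ^ 2)) by (apply sqrt_le_1_alt; nra). lra.
Qed.

(** With [z = |x + i y|] one has [N^2 = 2 z^2 / (z + x)], which increases in [z] when [x >= 0]. *)
Lemma nval_incr_y (x y y' : R) :
  0 <= x -> 0 < x \/ y <> 0 -> Rabs y <= y' -> nval x y <= nval x y'.
Proof.
  intros Hx Hxy Hy.
  assert (Hxy' : 0 < x \/ y' <> 0).
  { destruct Hxy as [H|H]; [now left|right]. apply Rabs_pos_lt in H. lra. }
  assert (Hr := reSqrt_pos x y Hx Hxy). assert (Hr' := reSqrt_pos x y' Hx Hxy').
  assert (E := reSqrt_pow2 x y). assert (E' := reSqrt_pow2 x y').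
  assert (Hz : sqrt (x ^ 2 + y ^ 2) <= sqrt (x ^ 2 + y' ^ 2)).
  { apply sqrt_le_1_alt. rewrite <- (pow2_abs y). assert (H := Rabs_pos y). nra. }
  assert (Hz0 := sqrt_pos (x ^ 2 + y ^ 2)).
  unfold nval. set (z := sqrt (x ^ 2 + y ^ 2)) in *. set (z' := sqrt (x ^ 2 + y' ^ 2)) in *.
  set (r := reSqrt x y) in *. set (r' := reSqrt x y') in *.
  apply Rmult_le_reg_r with (r * r'); [nra|].
  replace (z / r * (r * r')) with (z * r') by (field; lra).
  replace (z' / r' * (r * r')) with (z' * r) by (field; lra).
  apply Rsqr_incr_0; [|nra|nra]. unfold Rsqr.
  replace (z * r' * (z * r')) with (z * z * r' ^ 2) by ring.
  replace (z' * r * (z' * r)) with (z' * z' * r ^ 2) by ring. rewrite E, E'.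
  assert (0 <= z * z' * (z' - z)) by (apply Rmult_le_pos; nra).
  assert (0 <= x * ((z' - z) * (z' + z))) by (apply Rmult_le_pos; nra). nra.
Qed.

(* [4 v s^3 <= v^4 + 3 s^4] is the tangent-line bound of the convex function [s^-3] at [v]. *)
Lemma inv_cube_sum_max (Q s t v : R) :
  0 <= Q -> 0 < s <= v -> v <= t ->
  v + Q / v ^ 3 <= Rmax (s + Q / s ^ 3) (t + Q / t ^ 3).
Proof.
  intros HQ Hs Ht.
  assert (Htan : forall u, 0 < u ->
            v + Q / v ^ 3 + (u - v) * (1 - 3 * Q / v ^ 4) <= u + Q / u ^ 3).
  { intros u Hu.
    assert (Hu3 : 0 < u ^ 3) by (apply pow_lt; auto).
    assert (Hv4 : 0 < v ^ 4) by (apply pow_lt; lra).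
    assert (E : (u + Q / u ^ 3) - (v + Q / v ^ 3 + (u - v) * (1 - 3 * Q / v ^ 4))
                = Q * (v ^ 4 + 3 * u ^ 4 - 4 * v * u ^ 3) / (u ^ 3 * v ^ 4)) by (field; lra).
    assert (0 <= v ^ 4 + 3 * u ^ 4 - 4 * v * u ^ 3).
    { replace (v ^ 4 + 3 * u ^ 4 - 4 * v * u ^ 3)
        with ((v - u) ^ 2 * ((v + u) ^ 2 + 2 * u ^ 2)) by ring.
      apply Rmult_le_pos; [apply pow2_ge_0|].
      assert (H1 := pow2_ge_0 (v + u)). assert (H2 := pow2_ge_0 u). lra. }
    assert (0 <= Q * (v ^ 4 + 3 * u ^ 4 - 4 * v * u ^ 3) / (u ^ 3 * v ^ 4)).
    { apply Rdiv_le_0_compat; [now apply Rmult_le_pos|now apply Rmult_lt_0_compat]. }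
    lra. }
  destruct (Rle_dec 0 (1 - 3 * Q / v ^ 4)) as [H|H].
  - apply Rle_trans with (2 := Rmax_r _ _).
    assert (H1 := Htan t ltac:(lra)).
    assert (0 <= (t - v) * (1 - 3 * Q / v ^ 4)) by (apply Rmult_le_pos; lra). lra.
  - apply Rle_trans with (2 := Rmax_l _ _).
    assert (H1 := Htan s ltac:(lra)).
    assert (0 <= (v - s) * - (1 - 3 * Q / v ^ 4)) by (apply Rmult_le_pos; lra). lra.
Qed.

(** Monotonicity in [|y|] moves the point to the upper side. There the real part increases with [x]
    and [N] is convex in it, so an end of the side is at least as good. *)
Lemma nval_rectangle (x y X Y : R) :
  0 <= x <= X -> 0 < x \/ y <> 0 -> Rabs y <= Y -> 0 < Y ->
  nval x y <= Rmax (nval 0 Y) (nval X Y).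
Proof.
  intros Hx Hxy Hy HY.
  apply Rle_trans with (nval x Y); [apply nval_incr_y; auto; lra|].
  assert (HY0 : Y <> 0) by lra.
  rewrite !nval_reSqrt by (auto; lra).
  apply inv_cube_sum_max.
  - assert (H := pow2_ge_0 Y). lra.
  - split; [apply reSqrt_pos; auto; lra|]. apply reSqrt_incr_x; lra.
  - apply reSqrt_incr_x; lra.
Qed.

Lemma filterlim_nval (X Y : R -> R) :
  ex_derive X 0 -> ex_derive Y 0 -> 0 <= X 0 -> 0 < X 0 \/ Y 0 <> 0 ->
  filterlim (fun h => nval (X h) (Y h)) (at_right 0) (locally (nval (X 0) (Y 0))).
Proof.
  intros HX HY Hx Hxy.
  apply (filterlim_at_right_0_continuous (fun h => nval (X h) (Y h))).
  apply (ex_derive_continuous (V := R_NormedModule)).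
  assert (Hr := reSqrt_pos _ _ Hx Hxy).
  assert (Hr2 := proj1 (reSqrt_fixpoint _ _ Hx Hxy)). rewrite reSqrt_pow2 in Hr2.
  assert (Hz : 0 < X 0 ^ 2 + Y 0 ^ 2).
  { assert (H1 := pow2_ge_0 (X 0)). assert (H2 := pow2_ge_0 (Y 0)).
    destruct Hxy as [H|H]; [nra|]. assert (0 < Y 0 ^ 2) by (apply pow2_gt_0; auto). lra. }
  unfold nval, reSqrt in *. auto_derive.
  replace (X 0 * (X 0 * 1) + Y 0 * (Y 0 * 1)) with (X 0 ^ 2 + Y 0 ^ 2) by ring.
  repeat split; auto; lra.
Qed.

(** * Asymptotics of the supremum of [N] on the mesh *)

Lemma mesh_small (Ch W : R) (e : nat) :
  0 < Ch -> e = 1%nat \/ e = 2%nat ->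
  exists eta, 0 < eta /\ forall h, 0 < h < eta -> W <= PI / h /\ W <= PI / (Ch * h ^ e).
Proof.
  intros HCh He. assert (HPI := PI_RGT_0).
  set (V := Rmax W 1). assert (HV : 1 <= V) by apply Rmax_r. assert (HWV : W <= V) by apply Rmax_l.
  (* The bound [h < 1] gives [h ^ e <= h], so the same threshold serves both scalings. *)
  exists (Rmin 1 (Rmin (PI / V) (PI / (Ch * V)))). split.
  { repeat apply Rmin_pos; try lra; apply Rdiv_lt_0_compat; nra. }
  intros h [Hh Hlt].
  assert (H1 := Rlt_le_trans _ _ _ Hlt (Rmin_l _ _)).
  assert (H23 := Rlt_le_trans _ _ _ Hlt (Rmin_r _ _)).
  assert (H2 := Rlt_le_trans _ _ _ H23 (Rmin_l _ _)).
  assert (H3 := Rlt_le_trans _ _ _ H23 (Rmin_r _ _)).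
  assert (Hhe : 0 < h ^ e <= h) by (destruct He; subst e; simpl; nra).
  assert (Hdiv : forall u, 0 < u -> u * V <= PI -> W <= PI / u).
  { intros u Hu Hle. apply Rle_trans with V; auto. apply Rmult_le_reg_r with u; auto.
    unfold Rdiv; rewrite Rmult_assoc, Rinv_l by lra. lra. }
  split; apply Hdiv; try nra.
  - apply Rmult_lt_compat_r with (r := V) in H2; [|lra].
    unfold Rdiv in H2; rewrite Rmult_assoc, Rinv_l in H2 by lra. lra.
  - apply Rmult_lt_compat_r with (r := Ch * V) in H3; [|nra].
    unfold Rdiv in H3; rewrite Rmult_assoc, Rinv_l in H3 by nra.
    apply Rle_trans with (h * (Ch * V)); [|lra].
    apply Rle_trans with (Ch * V * h ^ e); [right; ring|].
    apply Rle_trans with (Ch * V * h); [|right; ring]. apply Rmult_le_compat_l; nra.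
Qed.

(** Scaling the argument of the root by [h^2] places it in a rectangle, since [h |k| <= pi] and
    [h^2 |w| <= (pi / Ch) h^(2 - e)]. *)
Lemma nval_inD_le (a b c nu km om Ch w k h : R) (e : nat) :
  0 < nu -> 0 <= b -> 0 < om -> 0 < Ch -> e = 1%nat \/ e = 2%nat -> 0 < h ->
  inD km om h (Ch * h ^ e) w k ->
  let Y := 4 * nu * (PI / Ch * h ^ (2 - e) + Rabs c * PI * h) in
  h * nval (symx a b nu k) (symy c nu w k)
  <= Rmax (nval 0 Y) (nval (h ^ 2 * x0sq a b nu + 4 * nu ^ 2 * PI ^ 2) Y).
Proof.
  intros Hnu Hb Hom HCh He Hh [[Hw1 Hw2] [Hk1 Hk2]] Y.
  assert (HPI := PI_RGT_0).
  assert (Hw0 : w <> 0) by (intros ->; rewrite Rabs_R0 in Hw1; lra).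
  assert (Hx := symx_nonneg a b nu k Hnu Hb). assert (Hxy := sym_nonzero a b c nu w k Hnu Hb Hw0).
  assert (Hh2 : 0 < h ^ 2) by (apply pow_lt; auto).
  rewrite nval_scale by auto.
  assert (Hhk : h * Rabs k <= PI).
  { apply Rmult_le_compat_l with (r := h) in Hk2; [|lra].
    replace (h * (PI / h)) with PI in Hk2 by (field; lra). lra. }
  assert (Hhw : h ^ 2 * Rabs w <= PI / Ch * h ^ (2 - e)).
  { apply Rmult_le_compat_l with (r := h ^ 2) in Hw2; [|lra].
    apply Rle_trans with (1 := Hw2). right. destruct He; subst e; simpl; field; lra. }
  apply nval_rectangle.
  - split; [apply Rmult_le_pos; lra|]. unfold symx. rewrite <- (pow2_abs k).
    assert (H : (h * Rabs k) ^ 2 <= PI ^ 2).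
    { apply pow_incr. split; auto. apply Rmult_le_pos; [lra|apply Rabs_pos]. }
    rewrite Rpow_mult_distr in H. assert (0 <= 4 * nu ^ 2) by nra. nra.
  - destruct Hxy as [H|H]; [left; now apply Rmult_lt_0_compat|right].
    apply Rmult_integral_contrapositive; lra.
  - unfold symy, Y. rewrite !Rabs_mult, (Rabs_pos_eq (h ^ 2)), (Rabs_pos_eq 4), (Rabs_pos_eq nu) by lra.
    assert (H : Rabs (w + c * k) <= Rabs w + Rabs c * Rabs k).
    { rewrite <- Rabs_mult. apply Rabs_triang. }
    apply Rle_trans with (4 * nu * (h ^ 2 * Rabs w + Rabs c * (h * Rabs k) * h)).
    + apply Rle_trans with (4 * nu * (h ^ 2 * (Rabs w + Rabs c * Rabs k))); [|right; ring].
      rewrite <- Rmult_assoc, (Rmult_comm (h ^ 2)), Rmult_assoc.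
      apply Rmult_le_compat_l; [lra|]. apply Rmult_le_compat_l; lra.
    + apply Rmult_le_compat_l; [lra|]. apply Rplus_le_compat; auto.
      apply Rmult_le_compat_r; [lra|]. apply Rmult_le_compat_l; auto. apply Rabs_pos.
  - unfold Y. apply Rmult_lt_0_compat; [lra|]. apply Rplus_lt_le_0_compat.
    + apply Rmult_lt_0_compat; [apply Rdiv_lt_0_compat; lra|apply pow_lt; auto].
    + apply Rmult_le_pos; [apply Rmult_le_pos; [apply Rabs_pos|lra]|lra].
Qed.

(** By homogeneity only [nval d 1] has to be computed. As [sqrt (2 * Y)] is the value at the corner
    [(0, Y)], the divisor is the ratio of the two corner values; it is the second branch of
    [Cconst]. *)
Lemma nval_aspect (d Y : R) :
  0 < d -> 0 < Y ->
  nval (d * Y) Y = sqrt (2 * Y) / sqrt ((d + sqrt (1 + d ^ 2)) / (1 + d ^ 2)).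
Proof.
  intros Hd HY.
  assert (Hs : 0 < sqrt (1 + d ^ 2)) by (apply sqrt_lt_R0; nra).
  assert (HsY : 0 < sqrt Y) by now apply sqrt_lt_R0.
  assert (H2 : 0 < sqrt 2) by (apply sqrt_lt_R0; lra).
  assert (Hsd : 0 < sqrt (d + sqrt (1 + d ^ 2))) by (apply sqrt_lt_R0; lra).
  replace (nval (d * Y) Y) with (nval (sqrt Y ^ 2 * d) (sqrt Y ^ 2 * 1))
    by (rewrite pow2_sqrt by lra; f_equal; ring).
  rewrite <- nval_scale by (auto; lra).
  unfold nval, reSqrt. replace (d ^ 2 + 1 ^ 2) with (1 + d ^ 2) by ring.
  rewrite (Rplus_comm _ d).
  rewrite sqrt_div_alt by lra. rewrite sqrt_div_alt by nra.
  rewrite sqrt_mult_alt by lra. field. lra.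
Qed.

(** Isolating the root and squaring leaves [d] times the cubic, whose sign thus decides which upper
    corner has the larger value. *)
Lemma aspect_cubic (d : R) :
  0 < d ->
  (d ^ 3 - 2 * d ^ 2 + 2 * d - 2 <= 0 -> 1 + d ^ 2 <= d + sqrt (1 + d ^ 2)) /\
  (0 <= d ^ 3 - 2 * d ^ 2 + 2 * d - 2 -> d + sqrt (1 + d ^ 2) <= 1 + d ^ 2).
Proof.
  intros Hd.
  assert (Hpos : 0 < 1 + d ^ 2 - d) by nra.
  assert (E : (1 + d ^ 2 - d) ^ 2 - (1 + d ^ 2) = d * (d ^ 3 - 2 * d ^ 2 + 2 * d - 2)) by ring.
  split; intros H.
  - enough (1 + d ^ 2 - d <= sqrt (1 + d ^ 2)) by lra.
    rewrite <- (sqrt_pow2 (1 + d ^ 2 - d)) by lra. apply sqrt_le_1_alt. nra.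
  - enough (sqrt (1 + d ^ 2) <= 1 + d ^ 2 - d) by lra.
    rewrite <- (sqrt_pow2 (1 + d ^ 2 - d)) by lra. apply sqrt_le_1_alt. nra.
Qed.

(** The difference of two values of the cubic is [d - d0] times a sum of squares. *)
Lemma cubic_incr (d d0 : R) :
  d0 ^ 3 - 2 * d0 ^ 2 + 2 * d0 - 2 = 0 ->
  (d < d0 -> d ^ 3 - 2 * d ^ 2 + 2 * d - 2 <= 0) /\
  (d0 <= d -> 0 <= d ^ 3 - 2 * d ^ 2 + 2 * d - 2).
Proof.
  intros H0.
  assert (E : d ^ 3 - 2 * d ^ 2 + 2 * d - 2
              = (d - d0) * ((d + d0 - 2) ^ 2 / 2 + d ^ 2 / 2 + d0 ^ 2 / 2)).
  { transitivity (d ^ 3 - 2 * d ^ 2 + 2 * d - 2 - (d0 ^ 3 - 2 * d0 ^ 2 + 2 * d0 - 2)).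
    - rewrite H0; ring.
    - field. }
  assert (H1 := pow2_ge_0 (d + d0 - 2)). assert (H2 := pow2_ge_0 d). assert (H3 := pow2_ge_0 d0).
  rewrite E. split; intros H; nra.
Qed.

Lemma filterlim_eventually_le (f : R -> R) (l n eps : R) :
  filterlim f (at_right 0) (locally l) -> l <= n -> 0 < n -> 0 < eps ->
  exists eta, 0 < eta /\ forall h, 0 < h < eta -> f h <= n * (1 + eps).
Proof.
  intros Hf Hl Hn Heps.
  destruct (proj2 (filterlim_at_right_0 f l) Hf (n * eps)) as [eta [Heta H]]; [nra|].
  exists eta. split; auto. intros h Hh. assert (H1 := H h Hh). apply Rabs_def2 in H1. lra.
Qed.

Lemma filterlim_eventually_ge (f : R -> R) (n eps : R) :
  filterlim f (at_right 0) (locally n) -> 0 < n -> 0 < eps ->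
  exists eta, 0 < eta /\ forall h, 0 < h < eta -> n * (1 - eps) <= f h.
Proof.
  intros Hf Hn Heps.
  destruct (proj2 (filterlim_at_right_0 f n) Hf (n * eps)) as [eta [Heta H]]; [nra|].
  exists eta. split; auto. intros h Hh. assert (H1 := H h Hh). apply Rabs_def2 in H1. lra.
Qed.

(** [Y0] is the height of the limiting rectangle, which collapses to a segment for [e = 1]. The
    bound passes to the limit at both upper corners. *)
Lemma nval_upper (a b c nu km om Ch n : R) (e : nat) :
  0 < nu -> 0 <= b -> 0 < om -> 0 < Ch -> e = 1%nat \/ e = 2%nat -> 0 < n ->
  let Y0 := match e with 1%nat => 0 | _ => 4 * nu * (PI / Ch) end in
  sqrt (2 * Y0) <= n -> nval (4 * nu ^ 2 * PI ^ 2) Y0 <= n ->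
  forall eps, 0 < eps -> exists eta, 0 < eta /\ forall h w k, 0 < h < eta ->
    inD km om h (Ch * h ^ e) w k -> h * nval (symx a b nu k) (symy c nu w k) <= n * (1 + eps).
Proof.
  intros Hnu Hb Hom HCh He Hn Y0 Hn1 Hn2 eps Heps.
  assert (HPI := PI_RGT_0).
  set (X := fun h => h ^ 2 * x0sq a b nu + 4 * nu ^ 2 * PI ^ 2).
  set (Y := fun h => 4 * nu * (PI / Ch * h ^ (2 - e) + Rabs c * PI * h)).
  assert (HY0 : Y 0 = Y0) by (unfold Y, Y0; destruct He; subst e; simpl; ring).
  assert (HX0 : X 0 = 4 * nu ^ 2 * PI ^ 2) by (unfold X; ring).
  assert (HYd : ex_derive Y 0) by (unfold Y; auto_derive; auto).
  assert (HXd : ex_derive X 0) by (unfold X; auto_derive; auto).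
  assert (HX0p : 0 < X 0).
  { rewrite HX0. assert (0 < nu ^ 2) by (apply pow_lt; auto).
    assert (0 < PI ^ 2) by (apply pow_lt; auto). nra. }
  (* The left corner is treated through [sqrt (2 * Y)]: for [e = 1] it tends to the origin, where
     the denominator of [nval] vanishes. *)
  assert (L1 : filterlim (fun h => sqrt (2 * Y h)) (at_right 0) (locally (sqrt (2 * Y0)))).
  { rewrite <- HY0. apply (filterlim_at_right_0_continuous (fun h => sqrt (2 * Y h))).
    apply continuous_sqrt_comp. apply (ex_derive_continuous (V := R_NormedModule)).
    auto_derive; auto. }
  assert (L2 : filterlim (fun h => nval (X h) (Y h)) (at_right 0)
                 (locally (nval (4 * nu ^ 2 * PI ^ 2) Y0))).
  { rewrite <- HX0, <- HY0. apply filterlim_nval; auto; lra. }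
  destruct (filterlim_eventually_le _ _ _ _ L1 Hn1 Hn Heps) as [eta1 [Heta1 H1]].
  destruct (filterlim_eventually_le _ _ _ _ L2 Hn2 Hn Heps) as [eta2 [Heta2 H2]].
  exists (Rmin eta1 eta2). split; [apply Rmin_pos; auto|].
  intros h w k [Hh Hlt] HD.
  assert (Hlt1 := Rlt_le_trans _ _ _ Hlt (Rmin_l _ _)).
  assert (Hlt2 := Rlt_le_trans _ _ _ Hlt (Rmin_r _ _)).
  apply Rle_trans with (1 := nval_inD_le a b c nu km om Ch w k h e Hnu Hb Hom HCh He Hh HD).
  apply Rmax_lub.
  - rewrite nval_0_l; [now apply H1|].
    apply Rmult_le_pos; [lra|]. apply Rplus_le_le_0_compat.
    + apply Rmult_le_pos; [apply Rdiv_le_0_compat; lra|apply pow_le; lra].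
    + apply Rmult_le_pos; [apply Rmult_le_pos; [apply Rabs_pos|lra]|lra].
  - now apply H2.
Qed.

(** At the largest [w] and the largest [k] the scaled argument tends to the right upper corner. *)
Lemma nval_lower_kmax (a b c nu km om Ch : R) (e : nat) :
  0 < nu -> 0 <= b -> 0 < om -> 0 < Ch -> e = 1%nat \/ e = 2%nat ->
  let Y0 := match e with 1%nat => 0 | _ => 4 * nu * (PI / Ch) end in
  let n := nval (4 * nu ^ 2 * PI ^ 2) Y0 in
  forall eps, 0 < eps -> exists eta, 0 < eta /\ forall h, 0 < h < eta -> exists w k,
    inD km om h (Ch * h ^ e) w k /\ n * (1 - eps) <= h * nval (symx a b nu k) (symy c nu w k).
Proof.
  intros Hnu Hb Hom HCh He Y0 n eps Heps.
  assert (HPI := PI_RGT_0).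
  set (X := fun h => h ^ 2 * x0sq a b nu + 4 * nu ^ 2 * PI ^ 2).
  set (Y := fun h => 4 * nu * (PI / Ch * h ^ (2 - e) + c * PI * h)).
  assert (HY0 : Y 0 = Y0) by (unfold Y, Y0; destruct He; subst e; simpl; ring).
  assert (HX0 : X 0 = 4 * nu ^ 2 * PI ^ 2) by (unfold X; ring).
  assert (HX0p : 0 < X 0).
  { rewrite HX0. assert (0 < nu ^ 2) by (apply pow_lt; auto).
    assert (0 < PI ^ 2) by (apply pow_lt; auto). nra. }
  assert (L : filterlim (fun h => nval (X h) (Y h)) (at_right 0) (locally n)).
  { unfold n. rewrite <- HX0, <- HY0.
    apply filterlim_nval; auto; try lra; unfold X, Y; auto_derive; auto. }
  assert (Hn : 0 < n) by (apply nval_bounds; rewrite <- HX0; lra).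
  destruct (filterlim_eventually_ge _ _ _ L Hn Heps) as [eta1 [Heta1 H1]].
  destruct (mesh_small Ch (Rmax km om) e HCh He) as [eta2 [Heta2 H2]].
  exists (Rmin eta1 eta2). split; [apply Rmin_pos; auto|].
  intros h [Hh Hlt].
  assert (Hlt1 := Rlt_le_trans _ _ _ Hlt (Rmin_l _ _)).
  assert (Hlt2 := Rlt_le_trans _ _ _ Hlt (Rmin_r _ _)).
  destruct (H2 h (conj Hh Hlt2)) as [Hk Hw].
  assert (Hm1 := Rmax_l km om). assert (Hm2 := Rmax_r km om).
  assert (Hhe : 0 < h ^ e) by (apply pow_lt; auto).
  assert (Hw0 : 0 < PI / (Ch * h ^ e)) by (apply Rdiv_lt_0_compat; nra).
  assert (Hk0 : 0 < PI / h) by (apply Rdiv_lt_0_compat; lra).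
  exists (PI / (Ch * h ^ e)), (PI / h). split.
  - unfold inD. rewrite !Rabs_pos_eq by lra. lra.
  - rewrite nval_scale; auto.
    + apply Rle_trans with (1 := H1 h (conj Hh Hlt1)). right. f_equal.
      * unfold X, symx. field. lra.
      * unfold Y, symy. destruct He; subst e; simpl; field; lra.
    + apply symx_nonneg; auto.
    + apply sym_nonzero; auto; lra.
Qed.

(** At the largest [w] and the smallest [k] the scaled argument tends to the left upper corner. *)
Lemma nval_lower_kmin (a b c nu km om Ch : R) :
  0 < nu -> 0 <= b -> 0 <= km -> 0 < om -> 0 < Ch ->
  let n := nval 0 (4 * nu * (PI / Ch)) in
  forall eps, 0 < eps -> exists eta, 0 < eta /\ forall h, 0 < h < eta -> exists w k,
    inD km om h (Ch * h ^ 2) w k /\ n * (1 - eps) <= h * nval (symx a b nu k) (symy c nu w k).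
Proof.
  intros Hnu Hb Hkm Hom HCh n eps Heps.
  assert (HPI := PI_RGT_0).
  set (X := fun h => h ^ 2 * symx a b nu km).
  set (Y := fun h => 4 * nu * (PI / Ch + c * km * h ^ 2)).
  assert (HY0 : Y 0 = 4 * nu * (PI / Ch)) by (unfold Y; ring).
  assert (HX0 : X 0 = 0) by (unfold X; ring).
  assert (HY0p : 0 < Y 0).
  { rewrite HY0. apply Rmult_lt_0_compat; [lra|]. apply Rdiv_lt_0_compat; lra. }
  assert (L : filterlim (fun h => nval (X h) (Y h)) (at_right 0) (locally n)).
  { replace n with (nval (X 0) (Y 0)) by now rewrite HX0, HY0.
    apply filterlim_nval; auto; try lra; unfold X, Y; auto_derive; auto. }
  assert (Hn : 0 < n) by (apply nval_bounds; rewrite <- ?HY0; lra).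
  destruct (filterlim_eventually_ge _ _ _ L Hn Heps) as [eta1 [Heta1 H1]].
  destruct (mesh_small Ch (Rmax km om) 2 HCh (or_intror eq_refl)) as [eta2 [Heta2 H2]].
  exists (Rmin eta1 eta2). split; [apply Rmin_pos; auto|].
  intros h [Hh Hlt].
  assert (Hlt1 := Rlt_le_trans _ _ _ Hlt (Rmin_l _ _)).
  assert (Hlt2 := Rlt_le_trans _ _ _ Hlt (Rmin_r _ _)).
  destruct (H2 h (conj Hh Hlt2)) as [Hk Hw].
  assert (Hm1 := Rmax_l km om). assert (Hm2 := Rmax_r km om).
  assert (Hhe : 0 < h ^ 2) by (apply pow_lt; auto).
  assert (Hw0 : 0 < PI / (Ch * h ^ 2)) by (apply Rdiv_lt_0_compat; nra).
  exists (PI / (Ch * h ^ 2)), km. split.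
  - unfold inD. rewrite !Rabs_pos_eq by lra. lra.
  - rewrite nval_scale; auto.
    + apply Rle_trans with (1 := H1 h (conj Hh Hlt1)). right. f_equal.
      unfold Y, symy. field. lra.
    + apply symx_nonneg; auto.
    + apply sym_nonzero; auto; lra.
Qed.

Lemma nval_sup_asymptotics (a b c nu km om Ch d0 : R) (e : nat) :
  0 < nu -> 0 <= b -> 0 <= km -> 0 < om -> 0 < Ch -> e = 1%nat \/ e = 2%nat ->
  d0 ^ 3 - 2 * d0 ^ 2 + 2 * d0 - 2 = 0 ->
  exists n, 0 < n /\ Bconst e d0 nu Ch = 4 / n /\
  (forall eps, 0 < eps -> exists eta, 0 < eta /\ forall h w k, 0 < h < eta ->
    inD km om h (Ch * h ^ e) w k -> h * nval (symx a b nu k) (symy c nu w k) <= n * (1 + eps)) /\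
  (forall eps, 0 < eps -> exists eta, 0 < eta /\ forall h, 0 < h < eta -> exists w k,
    inD km om h (Ch * h ^ e) w k /\ n * (1 - eps) <= h * nval (symx a b nu k) (symy c nu w k)).
Proof.
  intros Hnu Hb Hkm Hom HCh He Hd0. assert (HPI := PI_RGT_0).
  assert (HX0 : 0 < 4 * nu ^ 2 * PI ^ 2).
  { assert (0 < nu ^ 2) by (apply pow_lt; auto).
    assert (0 < PI ^ 2) by (apply pow_lt; auto). nra. }
  destruct He as [-> | ->].
  (* For [dt = Ch * h] the limiting height is [0], and the right end of the segment gives the
     maximum. *)
  - assert (E : nval (4 * nu ^ 2 * PI ^ 2) 0 = 2 * nu * PI).
    { rewrite nval_0_r by auto. replace (4 * nu ^ 2 * PI ^ 2) with ((2 * nu * PI) ^ 2) by ring.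
      apply sqrt_pow2. nra. }
    assert (Hn : 0 < 2 * nu * PI) by nra.
    exists (2 * nu * PI). split; auto. split; [unfold Bconst; field; lra|]. split.
    + apply (nval_upper a b c nu km om Ch _ 1); auto.
      * rewrite Rmult_0_r, sqrt_0. lra.
      * lra.
    + rewrite <- E. apply (nval_lower_kmax a b c nu km om Ch 1); auto.
  - set (d := nu * PI * Ch). set (Y0 := 4 * nu * (PI / Ch)).
    assert (Hd : 0 < d) by (apply Rmult_lt_0_compat; [apply Rmult_lt_0_compat|]; auto).
    assert (HY0 : 0 < Y0).
    { unfold Y0. apply Rmult_lt_0_compat; [lra|]. apply Rdiv_lt_0_compat; lra. }
    assert (EX : 4 * nu ^ 2 * PI ^ 2 = d * Y0) by (unfold d, Y0; field; lra).
    assert (Hs2d : 0 < sqrt (2 * d)) by (apply sqrt_lt_R0; lra).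
    assert (HsY : 0 < sqrt (2 * Y0)) by (apply sqrt_lt_R0; lra).
    (* This rewrites the denominator of [Bconst] through the left corner value [sqrt (2 * Y0)]. *)
    assert (Es : nu * PI = sqrt (2 * Y0) * sqrt (2 * d) / 4).
    { rewrite <- sqrt_mult_alt by lra.
      replace (2 * Y0 * (2 * d)) with ((4 * nu * PI) ^ 2) by (unfold d, Y0; field; lra).
      rewrite sqrt_pow2 by nra. field. }
    assert (EB : forall Cc, 0 < Cc -> Cc * sqrt (2 * d) / (nu * PI) = 4 / (sqrt (2 * Y0) / Cc)).
    { intros Cc HCc. rewrite Es. field. lra. }
    set (g := (d + sqrt (1 + d ^ 2)) / (1 + d ^ 2)).
    assert (Hs : 0 <= sqrt (1 + d ^ 2)) by apply sqrt_pos.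
    assert (Hd2 : 0 < 1 + d ^ 2) by nra.
    assert (Hg : 0 < g) by (apply Rdiv_lt_0_compat; lra).
    assert (Hsg : 0 < sqrt g) by now apply sqrt_lt_R0.
    assert (EnX : nval (4 * nu ^ 2 * PI ^ 2) Y0 = sqrt (2 * Y0) / sqrt g)
      by (rewrite EX; apply nval_aspect; auto).
    destruct (aspect_cubic d Hd) as [Hlow Hhigh]. destruct (cubic_incr d d0 Hd0) as [Hc1 Hc2].
    unfold Bconst, Cconst. fold d. fold g. destruct (Rlt_dec d d0) as [Hlt|Hge].
    (* Below [d0] the left corner dominates, and above it the right one. *)
    + assert (Hg1 : 1 <= g).
      { apply Rmult_le_reg_r with (1 + d ^ 2); auto. unfold g, Rdiv.
        rewrite Rmult_assoc, Rinv_l by lra. assert (H := Hlow (Hc1 Hlt)). lra. }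
      assert (Hsg1 : 1 <= sqrt g) by (rewrite <- sqrt_1; apply sqrt_le_1_alt; auto).
      exists (sqrt (2 * Y0)). split; auto. split.
      { rewrite EB by lra. now rewrite Rdiv_1_r. }
      split.
      * apply (nval_upper a b c nu km om Ch _ 2); auto.
        -- apply Rle_refl.
        -- fold Y0. rewrite EnX. apply Rmult_le_reg_r with (sqrt g); auto.
           unfold Rdiv; rewrite Rmult_assoc, Rinv_l by lra. nra.
      * rewrite <- nval_0_l by lra. apply (nval_lower_kmin a b c nu km om Ch); auto.
    + assert (Hg1 : g <= 1).
      { apply Rmult_le_reg_r with (1 + d ^ 2); auto. unfold g, Rdiv.
        rewrite Rmult_assoc, Rinv_l by lra.
        assert (H := Hhigh (Hc2 (Rnot_lt_le _ _ Hge))). lra. }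
      assert (Hsg1 : sqrt g <= 1) by (rewrite <- sqrt_1; apply sqrt_le_1_alt; auto).
      assert (Hn : 0 < sqrt (2 * Y0) / sqrt g) by now apply Rdiv_lt_0_compat.
      exists (sqrt (2 * Y0) / sqrt g). split; auto. split; [apply EB; auto|]. split.
      * apply (nval_upper a b c nu km om Ch _ 2); auto.
        -- fold Y0. apply Rmult_le_reg_r with (sqrt g); auto.
           unfold Rdiv; rewrite Rmult_assoc, Rinv_l by lra. nra.
        -- fold Y0. lra.
      * rewrite <- EnX. apply (nval_lower_kmax a b c nu km om Ch 2); auto.
Qed.

(** * The set of symbols on the mesh and the final assembly *)

Lemma rho_robin (a b c nu w k : R) (q : C) :
  rho a b c nu w k q (RtoC 0) 0
  = Cdiv (Cminus q (lam a b c nu w k)) (Cplus q (lam a b c nu w k)).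
Proof.
  unfold rho. replace (- 0 / (2 * nu)) with 0 by (unfold Rdiv; ring).
  rewrite !Cmult_0_l, Cplus_0_r.
  replace (cexp (RtoC 0)) with (RtoC 1); [now rewrite Cmult_1_r|].
  unfold cexp, RtoC, Re, Im; cbn [fst snd]. rewrite exp_0, cos_0, sin_0.
  apply injective_projections; cbn [fst snd]; ring.
Qed.

Definition spectrum (a b c nu km om h dt : R) (l : C) : Prop :=
  exists w k, inD km om h dt w k /\ l = lam a b c nu w k.

Lemma supRobin_robinSup (a b c nu km om h dt : R) (q : C) :
  supRobin a b c nu km om h dt q = robinSup (spectrum a b c nu km om h dt) q.
Proof.
  apply Lub_Rbar_eqset. intros s. split.
  - intros [w [k [HD ->]]]. exists (lam a b c nu w k). rewrite rho_robin.
    split; auto. now exists w, k.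
  - intros [l [[w [k [HD ->]]] ->]]. exists w, k. now rewrite rho_robin.
Qed.

Lemma normsq_lam_bound (a b c nu km om h dt : R) :
  0 < nu -> 0 <= b -> 0 < h -> 0 < dt ->
  exists M, forall l, spectrum a b c nu km om h dt l -> fst l <= M /\ normsq l <= M ^ 2.
Proof.
  intros Hnu Hb Hh Hdt. assert (HX := x0sq_nonneg a b nu Hnu Hb).
  set (x1 := symx a b nu (PI / h)). set (y1 := 4 * nu * (PI / dt + Rabs c * (PI / h))).
  (* The summand [1] lets the bound [x1 + y1] on [|l|^2] be absorbed into [M ^ 2]. *)
  exists (x1 + y1 + 1).
  intros l [w [k [[[_ Hw] [_ Hk]] ->]]].
  assert (Hx := symx_nonneg a b nu k Hnu Hb).
  assert (Hx1 : symx a b nu k <= x1).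
  { unfold x1, symx. rewrite <- (pow2_abs k). apply Rplus_le_compat_l.
    apply Rmult_le_compat_l; [assert (H := pow2_ge_0 nu); lra|].
    apply pow_incr. split; [apply Rabs_pos|auto]. }
  assert (Hy1 : Rabs (symy c nu w k) <= y1).
  { unfold symy, y1. rewrite Rabs_mult, (Rabs_pos_eq (4 * nu)) by lra.
    apply Rmult_le_compat_l; [lra|]. apply Rle_trans with (1 := Rabs_triang _ _).
    rewrite Rabs_mult. apply Rplus_le_compat; auto.
    apply Rmult_le_compat_l; auto. apply Rabs_pos. }
  assert (Hy0 := Rabs_pos (symy c nu w k)).
  assert (Hn : normsq (lam a b c nu w k) <= x1 + y1).
  { rewrite lam_csqrt, normsq_csqrt. rewrite <- (sqrt_pow2 (x1 + y1)) by lra.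
    apply sqrt_le_1_alt. rewrite <- (pow2_abs (symy c nu w k)). nra. }
  assert (Hn2 : normsq (lam a b c nu w k) <= (x1 + y1 + 1) ^ 2) by nra.
  split; auto. unfold normsq in Hn2.
  assert (H := pow2_ge_0 (snd (lam a b c nu w k))).
  apply Rnot_lt_le; intros Hlt. nra.
Qed.

Lemma spectrum_conj (a b c nu km om h dt : R) (l : C) :
  0 < nu -> 0 <= b -> spectrum a b c nu km om h dt l ->
  spectrum a b c nu km om h dt (fst l, - snd l).
Proof.
  intros Hnu Hb [w [k [[Hw Hk] ->]]]. exists (- w), (- k). split.
  - unfold inD. now rewrite !Rabs_Ropp.
  - rewrite !lam_csqrt, <- csqrt_conj by now apply symx_nonneg.
    apply (f_equal csqrt), injective_projections; cbn [fst snd]; unfold symx, symy; ring.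
Qed.

(** The real part of [l^2] is recovered from [l] as [2 (Re l)^2 - |l|^2]. *)
Lemma lam_symx_inj (a b c nu w k w' k' : R) :
  lam a b c nu w k = lam a b c nu w' k' -> symx a b nu k = symx a b nu k'.
Proof.
  rewrite !lam_csqrt. intros E.
  assert (E1 := f_equal normsq E). rewrite !normsq_csqrt in E1.
  assert (E2 : reSqrt (symx a b nu k) (symy c nu w k) = reSqrt (symx a b nu k') (symy c nu w' k'))
    by exact (f_equal fst E).
  assert (E3 := reSqrt_pow2 (symx a b nu k) (symy c nu w k)). rewrite E2, reSqrt_pow2 in E3. lra.
Qed.

Lemma spectrum_not_singleton (a b c nu km om h dt : R) (q : C) :
  0 < nu -> 0 <= km -> 0 < om -> om <= PI / dt -> km + 1 <= PI / h ->
  exists l, spectrum a b c nu km om h dt l /\ l <> q.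
Proof.
  intros Hnu Hkm Hom Hdt Hh.
  destruct (classic (lam a b c nu om km = q)) as [E|E].
  - exists (lam a b c nu om (km + 1)). split.
    + exists om, (km + 1). split; auto. unfold inD. rewrite !Rabs_pos_eq by lra. lra.
    + intros E'. assert (H : symx a b nu km = symx a b nu (km + 1))
        by (apply (lam_symx_inj a b c nu om km om); congruence).
      unfold symx in H. assert (0 < nu ^ 2) by (apply pow_lt; auto). nra.
  - exists (lam a b c nu om km). split; auto.
    exists om, km. split; auto. unfold inD. rewrite !Rabs_pos_eq by lra. lra.
Qed.

Theorem theorem1
  (nu b a c km om Ch : R) (e : nat) (d0 : R)
  (Hnu : 0 < nu) (Hb : 0 <= b) (Hkm : 0 <= km) (Hom : 0 < om) (HCh : 0 < Ch)
  (He : e = 1%nat \/ e = 2%nat)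
  (Hd0 : d0 ^ 3 - 2 * d0 ^ 2 + 2 * d0 - 2 = 0) :
  let dt := fun h => Ch * h ^ e in
  let A := Aconst a b c nu km om in
  let B := Bconst e d0 nu Ch in
  exists h0 : R, 0 < h0 /\
  exists (pstar : R -> C) (dstar : R -> R),
    (forall h, 0 < h < h0 ->
       supRobin a b c nu km om h (dt h) (pstar h) = Finite (dstar h) /\
       (forall q : C, Rbar_le (supRobin a b c nu km om h (dt h) (pstar h))
                              (supRobin a b c nu km om h (dt h) q)) /\
       (forall q : C, Rbar_le (supRobin a b c nu km om h (dt h) q)
                              (supRobin a b c nu km om h (dt h) (pstar h)) ->
                      q = pstar h)) /\
    filterlim (fun h => Cmod (Cminus (Cdiv (pstar h) (RtoC (sqrt (A / (B * h))))) (RtoC 1)))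
              (at_right 0) (locally 0) /\
    filterlim (fun h => (1 - dstar h) / ((1 / 2) * sqrt (A * B * h)))
              (at_right 0) (locally 1).
Proof.
  intros dt A B.
  destruct (reSqrt_min a b c nu km om Hnu Hb Hkm Hom) as [Hmin [wm [kmin [Hwm [Hkmin Em]]]]].
  destruct (nval_sup_asymptotics a b c nu km om Ch d0 e Hnu Hb Hkm Hom HCh He Hd0)
    as [n [Hn [EB [Hup Hlow]]]].
  fold A in Hmin, Em. fold B in EB. set (m := A / 4) in *.
  assert (EA : A = 4 * m) by (unfold m; field).
  assert (Hm : 0 < m).
  { rewrite Em. apply reSqrt_pos; [now apply symx_nonneg|]. apply sym_nonzero; auto.
    intros ->. rewrite Rabs_R0 in Hwm. lra. }
  (* This size puts the minimizing frequencies [(wm, kmin)] into the mesh range and leaves room for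
     [km + 1], which yields a second symbol. *)
  destruct (mesh_small Ch (Rabs wm + Rabs kmin + om + km + 1) e HCh He) as [h0 [Hh0 Hmesh]].
  assert (Hwm0 := Rabs_pos wm). assert (Hkm0 := Rabs_pos kmin).
  set (K := fun h => spectrum a b c nu km om h (dt h)).
  assert (Hdt : forall h, 0 < h -> 0 < dt h)
    by (intros h Hh; apply Rmult_lt_0_compat; [auto|apply pow_lt; auto]).
  assert (HKm : forall h l, K h l -> m <= fst l).
  { intros h l [w [k [[[Hw _] [Hk _]] ->]]]. rewrite fst_lam. auto. }
  (* Placing the range of [h] under the existential allows a choice for every [h], with [(0, 0)] as
     default outside the range. *)
  assert (Hex : forall h, exists pT : R * R, 0 < h < h0 ->
    0 < fst pT /\ 1 <= snd pT /\
    (forall l, K h l -> gval (fst pT) (fst l) (normsq l / fst l) <= snd pT) /\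
    (forall p' T', 0 < p' ->
       (forall l, K h l -> gval p' (fst l) (normsq l / fst l) <= T') -> snd pT <= T') /\
    robinSup (K h) (RtoC (fst pT)) = Finite (sqrt ((snd pT - 1) / (snd pT + 1))) /\
    (forall q, Rbar_le (robinSup (K h) q) (robinSup (K h) (RtoC (fst pT))) ->
       q = RtoC (fst pT))).
  { intros h. destruct (classic (0 < h < h0)) as [Hh|Hh]; [|now exists (0, 0)].
    destruct (normsq_lam_bound a b c nu km om h (dt h)) as [M HM]; auto; try lra.
    { apply Hdt; lra. }
    destruct (Hmesh h Hh) as [Hm1 Hm2].
    destruct (robin_minimax (K h) m M) as [p [T HpT]]; auto.
    - intros l Hl. split; [now apply (HKm h)|now apply HM].
    - intros l Hl. now apply HM.
    - intros l [w [k [_ ->]]]. rewrite lam_csqrt. apply snd_csqrt_le. now apply symx_nonneg.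
    - intros l Hl. now apply spectrum_conj.
    - intros q. apply spectrum_not_singleton; auto; unfold dt; lra.
    - exists (p, T). intros _. exact HpT. }
  set (f := fun h => proj1_sig (constructive_indefinite_description _ (Hex h))).
  assert (Hf : forall h, 0 < h < h0 ->
    0 < fst (f h) /\ 1 <= snd (f h) /\
    (forall l, K h l -> gval (fst (f h)) (fst l) (normsq l / fst l) <= snd (f h)) /\
    (forall p' T', 0 < p' ->
       (forall l, K h l -> gval p' (fst l) (normsq l / fst l) <= T') -> snd (f h) <= T') /\
    robinSup (K h) (RtoC (fst (f h))) = Finite (sqrt ((snd (f h) - 1) / (snd (f h) + 1))) /\
    (forall q, Rbar_le (robinSup (K h) q) (robinSup (K h) (RtoC (fst (f h)))) ->
       q = RtoC (fst (f h)))).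
  { intros h. exact (proj2_sig (constructive_indefinite_description _ (Hex h))). }
  set (p := fun h => fst (f h)). set (T := fun h => snd (f h)).
  destruct (minimax_asymptotics
              (fun h r N => exists l, K h l /\ r = fst l /\ N = normsq l / fst l) m n h0 p T)
    as [Hp HT]; auto.
  { intros h r N Hh [l [Hl [-> ->]]]. split; [now apply (HKm h)|].
    destruct Hl as [w [k [[[Hw _] _] ->]]]. rewrite normsq_lam_div, fst_lam.
    apply nval_bounds; [now apply symx_nonneg|]. apply sym_nonzero; auto.
    intros ->. rewrite Rabs_R0 in Hw. lra. }
  { intros h Hh. destruct (Hmesh h Hh) as [Hm1 Hm2]. fold (dt h) in Hm2.
    exists (normsq (lam a b c nu wm kmin) / fst (lam a b c nu wm kmin)), (lam a b c nu wm kmin).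
    split; [|split; [now rewrite fst_lam|reflexivity]].
    exists wm, kmin. split; auto. unfold inD. lra. }
  { intros eps Heps. destruct (Hup eps Heps) as [eta [Heta H]]. exists eta. split; auto.
    intros h r N Hh [l [[w [k [HD ->]]] [_ ->]]]. rewrite normsq_lam_div. now apply H. }
  { intros eps Heps. destruct (Hlow eps Heps) as [eta [Heta H]]. exists eta. split; auto.
    intros h Hh. destruct (H h Hh) as [w [k [HD HN]]].
    exists (fst (lam a b c nu w k)), (normsq (lam a b c nu w k) / fst (lam a b c nu w k)). split.
    - exists (lam a b c nu w k). split; auto. now exists w, k.
    - now rewrite normsq_lam_div. }
  { intros h Hh. destruct (Hf h Hh) as [H1 [_ [H2 [H3 _]]]]. split; auto. split.
    - intros r N [l [Hl [-> ->]]]. now apply H2.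
    - intros p' T' Hp' H. apply (H3 p' T' Hp'). intros l Hl. apply H. now exists l. }
  assert (EP : forall h, 0 < h -> A / (B * h) = m * n / h)
    by (intros h Hh; rewrite EA, EB; field; lra).
  assert (HP : forall h, 0 < h -> 0 < sqrt (m * n / h)).
  { intros h Hh. apply sqrt_lt_R0, Rdiv_lt_0_compat; nra. }
  (* With [A = 4 m] and [B = 4 / n], the inverse of the leading term of [T] is the claimed leading
     term of [1 - delta]. *)
  assert (ET : forall h, 0 < h ->
             1 / 2 * sqrt (A * B * h) = / (sqrt (m * n / h) / (2 * m))).
  { intros h Hh. assert (H := HP h Hh).
    assert (H1 : sqrt (A * B * h) * sqrt (m * n / h) = 4 * m).
    { rewrite <- sqrt_mult_alt.
      - rewrite <- (sqrt_pow2 (4 * m)) by lra. f_equal. rewrite EA, EB. field. lra.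
      - rewrite EA, EB. apply Rmult_le_pos; [|lra]. apply Rmult_le_pos; [lra|].
        apply Rdiv_le_0_compat; lra. }
    replace (sqrt (A * B * h)) with (4 * m / sqrt (m * n / h)) by (rewrite <- H1; field; lra).
    field. lra. }
  exists h0. split; auto.
  exists (fun h => RtoC (p h)), (fun h => sqrt ((T h - 1) / (T h + 1))). split; [|split].
  - intros h Hh. destruct (Hf h Hh) as [_ [_ [_ [_ [Hs Hu]]]]].
    rewrite supRobin_robinSup. split; [exact Hs|].
    assert (Hu' : forall q, Rbar_le (supRobin a b c nu km om h (dt h) q)
                    (robinSup (K h) (RtoC (p h))) -> q = RtoC (p h)).
    { intros q. rewrite supRobin_robinSup. apply Hu. }
    split; auto. intros q.
    (* Minimality follows from uniqueness: a [q] with a strictly smaller supremum would have to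
       equal [p h]. *)
    destruct (Rbar_le_lt_dec (robinSup (K h) (RtoC (p h))) (supRobin a b c nu km om h (dt h) q))
      as [H|H]; auto.
    assert (E := Hu' q (Rbar_lt_le _ _ H)). subst q.
    rewrite supRobin_robinSup. apply Rbar_le_refl.
  - apply filterlim_at_right_0. intros eps Heps.
    destruct (proj2 (filterlim_at_right_0 _ _) Hp eps Heps) as [eta [Heta H]].
    exists eta. split; auto. intros h Hh.
    rewrite EP by lra. assert (HPh := HP h ltac:(lra)).
    rewrite <- RtoC_div by lra. rewrite <- RtoC_minus, Cmod_R, Rminus_0_r, Rabs_Rabsolu. now apply H.
  - assert (H0 : filterlim (fun h => / (sqrt (m * n / h) / (2 * m))) (at_right 0) (locally 0)).
    { apply filterlim_ext_loc with (f := fun h => 1 / 2 * sqrt (A * B * h)).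
      - apply at_right_0_intro with 1; [lra|]. intros h Hh. apply ET; lra.
      - replace 0 with (1 / 2 * sqrt (A * B * 0)) at 2 by (rewrite Rmult_0_r, sqrt_0; ring).
        apply (filterlim_at_right_0_continuous (fun h => 1 / 2 * sqrt (A * B * h))).
        apply (continuous_scal_r (1 / 2) (fun h : R => sqrt (A * B * h))).
        apply continuous_sqrt_comp.
        apply (ex_derive_continuous (V := R_NormedModule)). auto_derive; auto. }
    assert (Hd := one_minus_delta_asymptotics T _ HT H0).
    apply filterlim_ext_loc with
      (f := fun h => (1 - sqrt ((T h - 1) / (T h + 1))) * (sqrt (m * n / h) / (2 * m))).
    + apply at_right_0_intro with 1; [lra|]. intros h Hh. rewrite ET by lra.
      unfold Rdiv at 4. now rewrite Rinv_inv.
    + apply Hd. exists h0. split; auto. intros h Hh. split.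
      * apply Rdiv_lt_0_compat; [apply HP; lra|lra].
      * apply (Hf h Hh).
Qed.
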